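(* Let $W(z)=\dfrac{\arctan\sqrt{2e^{-z}-1}}{\sqrt{2e^{-z}-1}}$, with the principal branches of $\arctan$ and of the square root; $W$ is analytic on $|z|<\ln2$. For $|z|<\ln 2$, \[ W(z)=\sum_{n=0}^{\infty}(-1)^n\Bigg[\sum_{k=0}^{n}(-1)^kS(n,k)\frac{(2k)!!}{2k+1}\,{}_2F_1\Big(k+\tfrac12,k+1;k+\tfrac32;-1\Big)\Bigg]\frac{z^n}{n!}. \]
   Context: $S(n,k)$ are the Stirling numbers of the second kind, given by $\frac{(e^x-1)^k}{k!}=\sum_{n\ge k}S(n,k)\frac{x^n}{n!}$. $(2k)!!=2^kk!$. ${}_2F_1(\alpha,\beta;\gamma;z)=\sum_{n\ge0}\frac{(\alpha)_n(\beta)_n}{(\gamma)_n}\frac{z^n}{n!}$ is Gauss' hypergeometric function, where $(a)_n=a(a+1)\cdots(a+n-1)$. The value at $z=-1$ means the value of its analytic continuation to $\mathbb{C}\setminus(1,\infty)$. *)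

(* Defs.v *)
From Stdlib Require Import Reals ClassicalEpsilon Factorial.
From Coquelicot Require Import Coquelicot.
Open Scope R_scope.

Definition Cexp (z : C) : C :=
  (exp (Re z) * cos (Im z), exp (Re z) * sin (Im z)).

(* principal argument Arg w in (-PI, PI]  (value 0 at w = 0, irrelevant) *)
Definition Carg (w : C) : R :=
  let x := Re w in let y := Im w in
  if Rlt_dec 0 x then atan (y / x)
  else if Rlt_dec x 0 then
    (if Rle_dec 0 y then atan (y / x) + PI else atan (y / x) - PI)
  else
    if Rlt_dec 0 y then PI / 2
    else if Rlt_dec y 0 then - (PI / 2) else 0.

Definition Cln (w : C) : C := (ln (Cmod w), Carg w).

Definition Csqrt (w : C) : C :=
  if Ceq_dec w 0 then 0%C else Cexp (Cmult (Cln w) (/ 2)%C).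

Definition Carctan (u : C) : C :=
  Cmult (Cmult Ci (/ 2)%C)
        (Cminus (Cln (Cminus 1%C (Cmult Ci u))) (Cln (Cplus 1%C (Cmult Ci u)))).

Definition W (z : C) : C :=
  let u := Csqrt (Cminus (Cmult (RtoC 2) (Cexp (Copp z))) 1%C) in
  Cdiv (Carctan u) u.

Fixpoint stirling2 (n k : nat) : nat :=
  match n, k with
  | O, O => 1%nat
  | O, S _ => 0%nat
  | S _, O => 0%nat
  | S n', S k' => (S k' * stirling2 n' (S k') + stirling2 n' k')%nat
  end.

(* (2k)!! = 2^k k! *)
Definition dfact_even (k : nat) : nat := (2 ^ k * fact k)%nat.

Fixpoint poch (a : R) (n : nat) : R :=
  match n with
  | O => 1
  | S m => poch a m * (a + INR m)
  end.

Definition hyp_term (a b c : R) (z : C) (n : nat) : C :=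
  Cmult (RtoC (poch a n * poch b n / poch c n / INR (fact n))) (Cpow z n).

Definition cut_plane (w : C) : Prop := ~ (Im w = 0 /\ 1 <= Re w).

(* v is the value at z of the analytic continuation of 2F1(a,b;c;.) to the
   cut plane: some function holomorphic on the cut plane, equal to the sum of
   the hypergeometric series on the open unit disc, takes value v at z. *)
Definition is_hyp2F1_value (a b c : R) (z v : C) : Prop :=
  exists f : C -> C,
    (forall w, cut_plane w -> ex_derive (K := C_AbsRing) (V := C_NormedModule) f w) /\
    (forall w, Cmod w < 1 -> is_series (V := C_NormedModule) (hyp_term a b c w) (f w)) /\
    f z = v.

Definition hyp2F1 (a b c : R) (z : C) : C :=
  epsilon (inhabits 0%C) (fun v => is_hyp2F1_value a b c z v).

Definition coef (n : nat) : C :=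
  sum_n (fun k =>
    Cmult (RtoC ((-1) ^ k * INR (stirling2 n k) * INR (dfact_even k) / (2 * INR k + 1)))
          (hyp2F1 (INR k + / 2) (INR k + 1) (INR k + 3 / 2) (RtoC (-1)))) n.

(* Main.v *)
(** With [t = exp (-z)] one has [W z = int_0^1 ds / (1 + (2 t - 1) s^2)].  Since [|1 - t| < 1],
    expanding the integrand geometrically around [t = 1] gives
    [W z = sum_k (-2)^k J_k (t - 1)^k] with [J_k = int_0^1 s^(2k) / (1 + s^2)^(k+1) ds], and
    [(2k+1) J_k] is the Euler integral of [2F1(k+1/2, k+1; k+3/2; -1)].  Substituting
    [(exp (-z) - 1)^k = k! sum_n S(n,k) (-z)^n / n!] and exchanging the sums gives the theorem:
    the double series is dominated by [sum_k (exp |z| - 1)^k], which converges for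
    [|z| < ln 2]. *)

Require Import Defs.
From Stdlib Require Import Reals Factorial Lra Lia Psatz ClassicalEpsilon.
From Coquelicot Require Import Coquelicot.
Open Scope R_scope.

(** The point -1 lies on the circle of convergence of the hypergeometric series, and [hyp2F1] is an
    [epsilon] over values of functions holomorphic on the whole cut plane, so a continuation must be
    exhibited before its value can be named. The Euler integral with a free parameter, [J k w], is
    that continuation: off the cut its integrand has no pole, and on the disc its series comes from
    termwise integration. The same family represents [W]: [W z] is [J 0] at [w = 1 - 2 exp (-z)],
    and [z = 0] corresponds to [w = -1], which is why the coefficients are values at -1. The bound
    [s^2 / (1 + s^2) <= 1/2] on [0,1] gives [|J k (-1)| <= 2^(-k)], which cancels the [2^k] of the
    double factorial. The branches are the other obstacle. The principal arctangent of [u] is a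
    difference of logarithms, integrated along the segments from 1 to [1 - i u] and [1 + i u]; these
    avoid the negative axis when [Re u > 0]. That positivity holds because the radicand never meets
    the nonpositive real axis. *)

(** * Finite sums and series of complex numbers *)

Lemma Cpow_0_r (c : C) : Cpow c 0 = 1%C.
Proof. reflexivity. Qed.

Definition Csum (a : nat -> C) (n : nat) : C := sum_n (G := C_AbelianGroup) a n.

Lemma Csum_0 (a : nat -> C) : Csum a 0 = a 0%nat.
Proof. apply (sum_O a). Qed.

Lemma Csum_S (a : nat -> C) (n : nat) : Csum a (S n) = (Csum a n + a (S n))%C.
Proof. apply (sum_Sn a). Qed.

Lemma Csum_ext (a b : nat -> C) (n : nat) :
  (forall k, (k <= n)%nat -> a k = b k) -> Csum a n = Csum b n.
Proof. intros H; apply sum_n_ext_loc; exact H. Qed.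

Lemma Csum_scal (c : C) (a : nat -> C) (n : nat) :
  Csum (fun k => c * a k)%C n = (c * Csum a n)%C.
Proof. apply (sum_n_mult_l (K := C_Ring) c a). Qed.

Lemma Csum_minus (a b : nat -> C) (n : nat) :
  Csum (fun k => a k - b k)%C n = (Csum a n - Csum b n)%C.
Proof.
  induction n as [|n IH]; [now rewrite !Csum_0 | rewrite !Csum_S, IH; ring].
Qed.

Lemma Csum_switch (t : nat -> nat -> C) (m n : nat) :
  Csum (fun i => Csum (t i) n) m = Csum (fun k => Csum (fun i => t i k) m) n.
Proof. apply (sum_n_switch t). Qed.

Lemma Cmod_Csum (a : nat -> C) (b : nat -> R) (n : nat) :
  (forall k, (k <= n)%nat -> Cmod (a k) <= b k) -> Cmod (Csum a n) <= sum_n b n.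
Proof.
  induction n as [|n IH]; intros H.
  - rewrite Csum_0, sum_O; apply H; lia.
  - rewrite Csum_S, sum_Sn.
    apply Rle_trans with (1 := Cmod_triangle _ _).
    apply Rplus_le_compat; [apply IH; intros k Hk|]; apply H; lia.
Qed.

(** Turns convergence in C into a real null sequence, so that real limit lemmas and squeezing apply
    everywhere below. *)
Lemma is_series_C_iff (a : nat -> C) (l : C) :
  is_series (V := C_NormedModule) a l <->
  is_lim_seq (fun n => Cmod (Csum a n - l)%C) 0.
Proof.
  unfold is_series.
  rewrite (filterlim_locally_ball_norm (U := C_NormedModule)).
  rewrite <- is_lim_seq_spec.
  split; intros H eps; specialize (H eps); revert H; apply filter_imp;
    intros n; unfold ball_norm; rewrite Rminus_0_r, (Rabs_pos_eq _ (Cmod_ge_0 _));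
    intros H; exact H.
Qed.

Lemma is_lim_seq_le_0 (u v : nat -> R) :
  (forall n, 0 <= u n <= v n) -> is_lim_seq v 0 -> is_lim_seq u 0.
Proof.
  intros H Hv; apply is_lim_seq_le_le with (u := fun _ => 0) (w := v); auto.
  apply is_lim_seq_const.
Qed.

Lemma is_series_C_le (a : nat -> C) (l : C) (e : nat -> R) :
  (forall n, Cmod (Csum a n - l)%C <= e n) -> is_lim_seq e 0 ->
  is_series (V := C_NormedModule) a l.
Proof.
  intros H He; apply is_series_C_iff, is_lim_seq_le_0 with (2 := He).
  intros n; split; [apply Cmod_ge_0 | apply H].
Qed.

Lemma is_series_C_scal (c : C) (a : nat -> C) (l : C) :
  is_series (V := C_NormedModule) a l ->
  is_series (V := C_NormedModule) (fun n => c * a n)%C (c * l)%C.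
Proof. apply (is_series_scal (V := C_NormedModule)). Qed.

Lemma is_series_C_ext (a b : nat -> C) (l : C) :
  (forall n, a n = b n) ->
  is_series (V := C_NormedModule) a l -> is_series (V := C_NormedModule) b l.
Proof. apply (is_series_ext (V := C_NormedModule)). Qed.

(** * Integrals over [0,1] of complex functions *)

(** Continuity is taken componentwise because integrability is obtained from the real theorem
    applied to each component. *)
Definition Ccont (f : R -> C) : Prop := forall s, 0 <= s <= 1 ->
  continuous (fun t => Re (f t)) s /\ continuous (fun t => Im (f t)) s.

Definition Cint (f : R -> C) : C := RInt (V := C_R_CompleteNormedModule) f 0 1.

Lemma Ccont_const (c : C) : Ccont (fun _ => c).
Proof. intros s _; split; apply continuous_const. Qed.

Lemma Ccont_RtoC (f : R -> R) : (forall s, continuous f s) -> Ccont (fun s => RtoC (f s)).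
Proof. intros H s _; split; [apply H | apply continuous_const]. Qed.

Lemma Ccont_plus (f g : R -> C) : Ccont f -> Ccont g -> Ccont (fun s => f s + g s)%C.
Proof.
  intros Hf Hg s Hs; destruct (Hf s Hs), (Hg s Hs).
  split; apply (continuous_plus (V := R_NormedModule)); assumption.
Qed.

Lemma Ccont_opp (f : R -> C) : Ccont f -> Ccont (fun s => - f s)%C.
Proof.
  intros Hf s Hs; destruct (Hf s Hs).
  split; apply (continuous_opp (V := R_NormedModule)); assumption.
Qed.

Lemma Ccont_minus (f g : R -> C) : Ccont f -> Ccont g -> Ccont (fun s => f s - g s)%C.
Proof. intros Hf Hg; apply Ccont_plus; [|apply Ccont_opp]; assumption. Qed.

Lemma Ccont_mult (f g : R -> C) : Ccont f -> Ccont g -> Ccont (fun s => f s * g s)%C.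
Proof.
  intros Hf Hg s Hs; destruct (Hf s Hs), (Hg s Hs); split.
  - apply (continuous_minus (V := R_NormedModule)); apply (continuous_mult (K := R_AbsRing));
      assumption.
  - apply (continuous_plus (V := R_NormedModule)); apply (continuous_mult (K := R_AbsRing));
      assumption.
Qed.

Lemma Ccont_pow (f : R -> C) (n : nat) : Ccont f -> Ccont (fun s => Cpow (f s) n).
Proof.
  intros Hf; induction n as [|n IH]; [exact (Ccont_const 1%C)|].
  apply (Ccont_mult _ (fun s => Cpow (f s) n)); assumption.
Qed.

Lemma C_sqr_pos (c : C) : c <> 0%C -> 0 < fst c ^ 2 + snd c ^ 2.
Proof.
  intros H; apply sqrt_lt_0_alt; rewrite sqrt_0; apply (Cmod_gt_0 c), H.
Qed.

Lemma Ccont_inv (f : R -> C) :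
  (forall s, 0 <= s <= 1 -> f s <> 0%C) -> Ccont f -> Ccont (fun s => / f s)%C.
Proof.
  intros H0 Hf s Hs; destruct (Hf s Hs) as [H1 H2].
  assert (Hn : continuous (fun t => / (fst (f t) ^ 2 + snd (f t) ^ 2)) s).
  { apply continuous_Rinv_comp; [|apply Rgt_not_eq, C_sqr_pos, H0, Hs].
    apply (continuous_plus (V := R_NormedModule));
      (apply (continuous_mult (K := R_AbsRing));
       [|apply (continuous_mult (K := R_AbsRing)); [|apply continuous_const]]); assumption. }
  split; apply (continuous_mult (K := R_AbsRing)); try assumption.
  apply (continuous_opp (V := R_NormedModule)); assumption.
Qed.

Lemma is_RInt_Cint (f : R -> C) :
  Ccont f -> is_RInt (V := C_R_NormedModule) f 0 1 (Cint f).
Proof.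
  intros Hf; apply (RInt_correct (V := C_R_CompleteNormedModule)).
  destruct (ex_RInt_continuous (V := R_CompleteNormedModule) (fun t => Re (f t)) 0 1)
    as [l1 H1].
  { intros s; rewrite Rmin_left, Rmax_right by lra; intros Hs; apply (Hf s Hs). }
  destruct (ex_RInt_continuous (V := R_CompleteNormedModule) (fun t => Im (f t)) 0 1)
    as [l2 H2].
  { intros s; rewrite Rmin_left, Rmax_right by lra; intros Hs; apply (Hf s Hs). }
  exists (l1, l2).
  apply (is_RInt_fct_extend_pair (U := R_NormedModule) (V := R_NormedModule)); assumption.
Qed.

Lemma Cint_unique (f : R -> C) (l : C) :
  is_RInt (V := C_R_NormedModule) f 0 1 l -> Cint f = l.
Proof. apply (is_RInt_unique (V := C_R_CompleteNormedModule)). Qed.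

Lemma Cint_ext (f g : R -> C) :
  (forall s, 0 <= s <= 1 -> f s = g s) -> Cint f = Cint g.
Proof.
  intros H; apply (RInt_ext (V := C_R_CompleteNormedModule)).
  intros s; rewrite Rmin_left, Rmax_right by lra; intros Hs; apply H; lra.
Qed.

Lemma Cint_plus (f g : R -> C) :
  Ccont f -> Ccont g -> Cint (fun s => f s + g s)%C = (Cint f + Cint g)%C.
Proof.
  intros Hf Hg; apply Cint_unique.
  apply (is_RInt_plus (V := C_R_NormedModule)); apply is_RInt_Cint; assumption.
Qed.

(** The integral lives in C as a real vector space, where linearity covers real scalars only; a
    complex scalar mixes the two components, which are therefore integrated separately. *)
Lemma Cint_scal (c : C) (f : R -> C) :
  Ccont f -> Cint (fun s => c * f s)%C = (c * Cint f)%C.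
Proof.
  intros Hf; apply Cint_unique.
  pose proof (is_RInt_Cint f Hf) as H.
  pose proof (is_RInt_fct_extend_fst (U := R_NormedModule) (V := R_NormedModule) _ _ _ _ H) as H1.
  pose proof (is_RInt_fct_extend_snd (U := R_NormedModule) (V := R_NormedModule) _ _ _ _ H) as H2.
  apply (is_RInt_fct_extend_pair (U := R_NormedModule) (V := R_NormedModule)).
  - apply (is_RInt_minus (V := R_NormedModule)); apply (is_RInt_scal (V := R_NormedModule)); assumption.
  - apply (is_RInt_plus (V := R_NormedModule)); apply (is_RInt_scal (V := R_NormedModule)); assumption.
Qed.

Lemma Cint_minus (f g : R -> C) :
  Ccont f -> Ccont g -> Cint (fun s => f s - g s)%C = (Cint f - Cint g)%C.
Proof.
  intros Hf Hg; apply Cint_unique.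
  apply (is_RInt_minus (V := C_R_NormedModule)); apply is_RInt_Cint; assumption.
Qed.

Lemma Cmod_Cint (f : R -> C) (M : R) :
  Ccont f -> (forall s, 0 <= s <= 1 -> Cmod (f s) <= M) -> Cmod (Cint f) <= M.
Proof.
  intros Hf HM; replace M with ((1 - 0) * M) by ring.
  rewrite Cmod_norm.
  apply (norm_RInt_le_const (V := C_R_NormedModule) f); [lra | | apply is_RInt_Cint, Hf].
  intros s Hs; apply Rle_trans with (2 := HM s Hs).
  right; symmetry; apply (Cmod_norm (f s)).
Qed.

Lemma Ccont_Csum (h : nat -> R -> C) (n : nat) :
  (forall k, Ccont (h k)) -> Ccont (fun s => Csum (fun k => h k s) n).
Proof.
  intros H; induction n as [|n IH]; intros s Hs.
  - split; (eapply continuous_ext; [intros t; rewrite Csum_0; reflexivity|]); apply (H 0%nat s Hs).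
  - destruct (Ccont_plus _ _ IH (H (S n)) s Hs).
    split; (eapply continuous_ext; [intros t; rewrite Csum_S; reflexivity|]); assumption.
Qed.

Lemma Cint_Csum (h : nat -> R -> C) (n : nat) :
  (forall k, Ccont (h k)) ->
  Cint (fun s => Csum (fun k => h k s) n) = Csum (fun k => Cint (h k)) n.
Proof.
  intros H; induction n as [|n IH].
  - rewrite Csum_0; apply Cint_ext; intros s _; now rewrite Csum_0.
  - rewrite Csum_S, <- IH, <- Cint_plus; [|apply Ccont_Csum, H|apply H].
    apply Cint_ext; intros s _; now rewrite Csum_S.
Qed.

(** Termwise integration under uniform convergence: the interval has length 1, so the uniform error
    [e n] also bounds the error of the integrals. *)
Lemma is_series_Cint (h : nat -> R -> C) (g : R -> C) (e : nat -> R) :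
  (forall n, Ccont (h n)) -> Ccont g ->
  (forall n s, 0 <= s <= 1 -> Cmod (Csum (fun k => h k s) n - g s)%C <= e n) ->
  is_lim_seq e 0 ->
  is_series (V := C_NormedModule) (fun n => Cint (h n)) (Cint g).
Proof.
  intros Hh Hg He Hl; apply is_series_C_le with (2 := Hl); intros n.
  pose proof (Ccont_Csum h n Hh) as Hs.
  rewrite <- (Cint_Csum h n Hh), <- (Cint_minus _ _ Hs Hg).
  apply Cmod_Cint; [apply (Ccont_minus _ _ Hs Hg) | apply He].
Qed.

(** * Euler integrals and the hypergeometric values *)

(** Euler's integrand [t^(k-1/2) (1 - w t)^(-k-1)] after [t = s^2], up to a constant factor. The
    substitution removes the singularity at 0 that occurs for [k = 0]. *)
Definition ker (k : nat) (w : C) (s : R) : C :=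
  (RtoC (s ^ (2 * k)) * Cpow (/ (1 - w * RtoC (s ^ 2))) (S k))%C.

Definition J (k : nat) (w : C) : C := Cint (ker k w).

Lemma unit_pow (s : R) (n : nat) : 0 <= s <= 1 -> 0 <= s ^ n <= 1.
Proof.
  intros Hs; induction n as [|n IH]; simpl; [lra | nra].
Qed.

Lemma continuous_pow (n : nat) (s : R) : continuous (fun t : R => t ^ n) s.
Proof.
  apply (ex_derive_continuous (V := R_NormedModule)); auto_derive; trivial.
Qed.

Lemma cut_plane_neq (w : C) (s : R) :
  cut_plane w -> 0 <= s <= 1 -> (1 - w * RtoC (s ^ 2))%C <> 0%C.
Proof.
  destruct w as [a b]; unfold cut_plane; simpl; intros Hw Hs H; apply Hw.
  injection H; intros H2 H1.
  assert (Hp : s * s <> 0) by (intros E; rewrite Rmult_1_r, E in H1; lra).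
  assert (Hb : b * (s * s) = 0) by lra.
  split; [destruct (Rmult_integral _ _ Hb); [assumption | contradiction] |].
  assert (a * (s * s) = 1) by lra.
  assert (0 < s * s <= 1) by nra.
  nra.
Qed.

Lemma Ccont_ker_base (w : C) : Ccont (fun s => 1 - w * RtoC (s ^ 2))%C.
Proof.
  apply Ccont_minus; [apply Ccont_const|].
  apply (Ccont_mult (fun _ => w) (fun s => RtoC (s ^ 2))); [apply Ccont_const|].
  apply Ccont_RtoC; intros s; apply continuous_pow.
Qed.

Lemma Ccont_ker (k : nat) (w : C) : cut_plane w -> Ccont (ker k w).
Proof.
  intros Hw; apply Ccont_mult.
  - apply Ccont_RtoC; intros s; apply continuous_pow.
  - apply Ccont_pow, Ccont_inv; [intros s; apply cut_plane_neq, Hw | apply Ccont_ker_base].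
Qed.

(** Compactness of [0,1]: the squared modulus is a polynomial in [s], hence attains its minimum, and
    it does not vanish there. *)
Lemma cut_plane_lower_bound (w : C) :
  cut_plane w ->
  exists d, 0 < d /\ forall s, 0 <= s <= 1 -> d <= Cmod (1 - w * RtoC (s ^ 2))%C.
Proof.
  intros Hw.
  destruct (continuity_ab_min
    (fun s => fst (1 - w * RtoC (s ^ 2))%C ^ 2 + snd (1 - w * RtoC (s ^ 2))%C ^ 2) 0 1)
    as [m [Hm Hm1]]; [lra | |].
  - intros s _; apply derivable_continuous_pt, ex_derive_Reals_0.
    destruct w as [a b]; simpl; auto_derive; trivial.
  - exists (Cmod (1 - w * RtoC (m ^ 2))%C); split.
    + apply Cmod_gt_0, cut_plane_neq; assumption.
    + intros s Hs; apply sqrt_le_1_alt; exact (Hm s Hs).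
Qed.

(* The hypothesis on [p - p0] is the resolvent identity for [p = 1 / (c - x)], [p0 = 1 / c]. *)
Lemma resolvent_pow_remainder (B : R) (m : nat) :
  exists K, 0 <= K /\ forall p p0 x : C,
    (p - p0 = x * p * p0)%C -> Cmod p <= B -> Cmod p0 <= B ->
    Cmod (Cpow p m - Cpow p0 m - RtoC (INR m) * x * Cpow p0 (S m))%C <= K * Cmod x ^ 2.
Proof.
  induction m as [|m [K [HK IH]]].
  - exists 0; split; [lra|]; intros p p0 x _ _ _.
    change (INR 0) with 0; rewrite !Cpow_0_r, Cpow_1_r.
    replace (1 - 1 - 0 * x * p0)%C with (RtoC 0) by ring.
    rewrite Cmod_0; lra.
  (* The constant must be nonnegative before any [p] is given, hence [Rabs B]; later
     [0 <= Cmod p <= B] removes it. The exponent counts [p0^(m+1)] and the extra factors [p] and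
     [p0]. *)
  - exists (Rabs B * K + INR (S m) * Rabs B ^ (m + 3)); split.
    { apply Rplus_le_le_0_compat; apply Rmult_le_pos; auto using Rabs_pos, pos_INR, pow_le. }
    intros p p0 x Hx Hp Hp0; specialize (IH p p0 x Hx Hp Hp0).
    (* Multiplying the remainder of order [m] by [p] leaves a defect with the factor [x * (p - p0)],
       which the resolvent identity makes quadratic in [x]. *)
    assert (E : (Cpow p (S m) - Cpow p0 (S m) - RtoC (INR (S m)) * x * Cpow p0 (S (S m)) =
      p * (Cpow p m - Cpow p0 m - RtoC (INR m) * x * Cpow p0 (S m)) +
      RtoC (INR (S m)) * x * Cpow p0 (S m) * (x * p * p0))%C).
    { assert (Hz : (p - p0 - x * p * p0 = 0)%C) by (rewrite Hx; ring).
      rewrite <- Hx, S_INR, RtoC_plus, !Cpow_S.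
      transitivity (p * (Cpow p m - Cpow p0 m - RtoC (INR m) * x * (p0 * Cpow p0 m)) +
        (RtoC (INR m) + 1) * x * (p0 * Cpow p0 m) * (p - p0) +
        (p - p0 - x * p * p0) * Cpow p0 m)%C; [ring | rewrite Hz; ring]. }
    rewrite E; apply Rle_trans with (1 := Cmod_triangle _ _).
    rewrite !Cmod_mult, !Cmod_pow, Cmod_R, (Rabs_pos_eq (INR (S m))) by apply pos_INR.
    rewrite Rmult_plus_distr_r.
    assert (HB : Rabs B = B) by (apply Rabs_pos_eq; pose proof (Cmod_ge_0 p); lra).
    rewrite HB; apply Rplus_le_compat.
    + rewrite Rmult_assoc; apply Rmult_le_compat; auto using Cmod_ge_0.
    + replace (INR (S m) * B ^ (m + 3) * Cmod x ^ 2)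
        with (INR (S m) * Cmod x ^ 2 * (B ^ S m * (B * B)))
        by (rewrite Nat.add_comm; simpl pow; ring).
      replace (_ * _ * _ * _) with (INR (S m) * Cmod x ^ 2 * (Cmod p0 ^ S m * (Cmod p * Cmod p0)))
        by ring.
      apply Rmult_le_compat_l;
        [apply Rmult_le_pos; [apply pos_INR | apply pow_le, Cmod_ge_0]|].
      apply Rmult_le_compat; auto using pow_le, Rmult_le_pos, Cmod_ge_0.
      * apply pow_incr; split; auto using Cmod_ge_0.
      * apply Rmult_le_compat; auto using Cmod_ge_0.
Qed.

Lemma Cmod_reverse_triangle (x y : C) : Cmod x - Cmod y <= Cmod (x - y)%C.
Proof.
  pose proof (Cmod_triangle (x - y) y) as H.
  replace (x - y + y)%C with x in H by ring; lra.
Qed.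

Lemma Cmod_inv_le (x : C) (d : R) : 0 < d -> d <= Cmod x -> Cmod (/ x)%C <= / d.
Proof.
  intros Hd H; rewrite Cmod_inv by (apply Cmod_gt_0; lra).
  apply Rinv_le_contravar; lra.
Qed.

(** First-order Taylor expansion in [w] with an error uniform in [s], which is what differentiation
    under the integral needs. The inner derivative contributes [s^2], turning [s^(2k)] into the
    [s^(2(k+1))] of [ker (S k)]. *)
Lemma ker_remainder (k : nat) (w0 : C) :
  cut_plane w0 ->
  exists d K, 0 < d /\ 0 <= K /\ forall w, Cmod (w - w0)%C < d ->
    cut_plane w /\ forall s, 0 <= s <= 1 ->
    Cmod (ker k w s - ker k w0 s - (w - w0) * RtoC (INR (S k)) * ker (S k) w0 s)%C
      <= K * Cmod (w - w0)%C ^ 2.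
Proof.
  intros Hw0; destruct (cut_plane_lower_bound w0 Hw0) as [d [Hd Hlow]].
  destruct (resolvent_pow_remainder (/ (d / 2)) (S k)) as [K [HK HE]].
  exists (d / 2), K; split; [lra | split; [exact HK | intros w Hw]].
  (* Since [s^2 <= 1], moving [w0] by less than [d / 2] costs at most half of the lower bound
     [d]. *)
  assert (Hnear : forall s, 0 <= s <= 1 -> d / 2 <= Cmod (1 - w * RtoC (s ^ 2))%C).
  { intros s Hs; specialize (Hlow s Hs).
    replace (1 - w * RtoC (s ^ 2))%C
      with ((1 - w0 * RtoC (s ^ 2)) - (w - w0) * RtoC (s ^ 2))%C by ring.
    apply Rle_trans with (2 := Cmod_reverse_triangle _ _).
    rewrite Cmod_mult, Cmod_R.
    destruct (unit_pow s 2 Hs); rewrite Rabs_pos_eq by assumption.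
    pose proof (Cmod_ge_0 (w - w0)%C); nra. }
  split.
  (* A point [a >= 1] of the cut would make the denominator vanish at [s = sqrt (1/a)], against the
     lower bound. *)
  { intros [Hi Hr]; destruct w as [a b]; simpl in Hi, Hr; subst b.
    assert (Ha : 0 < / a) by (apply Rinv_0_lt_compat; lra).
    assert (Hs : 0 <= sqrt (/ a) <= 1).
    { split; [apply sqrt_pos|].
      rewrite <- sqrt_1; apply sqrt_le_1_alt.
      rewrite <- Rinv_1; apply Rinv_le_contravar; lra. }
    specialize (Hnear _ Hs).
    rewrite pow2_sqrt in Hnear by lra.
    replace (1 - (a, 0) * RtoC (/ a))%C with (RtoC 0) in Hnear.
    - rewrite Cmod_0 in Hnear; lra.
    - apply injective_projections; simpl; field; lra. }
  intros s Hs; specialize (Hnear s Hs); specialize (Hlow s Hs).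
  unfold ker; set (q := (1 - w * RtoC (s ^ 2))%C) in *.
  set (q0 := (1 - w0 * RtoC (s ^ 2))%C) in *.
  specialize (HE (/ q)%C (/ q0)%C ((w - w0) * RtoC (s ^ 2))%C).
  assert (Hq : q <> 0%C) by (apply Cmod_gt_0; lra).
  assert (Hq0 : q0 <> 0%C) by (apply Cmod_gt_0; lra).
  match goal with |- Cmod ?e <= _ => replace e with (RtoC (s ^ (2 * k)) *
    (Cpow (/ q) (S k) - Cpow (/ q0) (S k) -
     RtoC (INR (S k)) * ((w - w0) * RtoC (s ^ 2)) * Cpow (/ q0) (S (S k))))%C end.
  2: { replace (2 * S k)%nat with (2 * k + 2)%nat by lia.
       rewrite pow_add, RtoC_mult; ring. }
  rewrite Cmod_mult, Cmod_R, Rabs_pos_eq by (apply unit_pow, Hs).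
  assert (Hx : Cmod ((w - w0) * RtoC (s ^ 2))%C <= Cmod (w - w0)%C).
  { rewrite Cmod_mult, Cmod_R; destruct (unit_pow s 2 Hs).
    rewrite Rabs_pos_eq by assumption; pose proof (Cmod_ge_0 (w - w0)%C); nra. }
  apply Rle_trans with (1 * (K * Cmod ((w - w0) * RtoC (s ^ 2))%C ^ 2)).
  - apply Rmult_le_compat; [apply unit_pow, Hs | apply Cmod_ge_0 | apply unit_pow, Hs |].
    apply HE.
    + unfold q, q0; field; split; assumption.
    + apply Cmod_inv_le; [lra | exact Hnear].
    + apply Cmod_inv_le; lra.
  - rewrite Rmult_1_l; apply Rmult_le_compat_l; [exact HK|].
    apply pow_incr; split; [apply Cmod_ge_0 | exact Hx].
Qed.

Lemma is_derive_J (k : nat) (w0 : C) :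
  cut_plane w0 ->
  is_derive (K := C_AbsRing) (V := C_NormedModule) (J k) w0 (RtoC (INR (S k)) * J (S k) w0)%C.
Proof.
  intros Hw0; destruct (ker_remainder k w0 Hw0) as [d [K [Hd [HK H]]]].
  split; [apply is_linear_scal_l|].
  intros x Hx.
  rewrite <- (is_filter_lim_locally_unique (V := AbsRing_NormedModule C_AbsRing) _ _ Hx).
  clear x Hx; intros [eps Heps].
  (* Within [eps / (K + 1)] the quadratic error is at most [eps] times the distance; [K + 1] avoids
     dividing by zero. *)
  assert (Hr : 0 < Rmin d (eps / (K + 1))).
  { apply Rmin_glb_lt; [exact Hd | apply Rdiv_lt_0_compat; lra]. }
  exists (mkposreal _ Hr); intros w Hw.
  change (Cmod (w - w0)%C < Rmin d (eps / (K + 1))) in Hw.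
  change (Cmod (J k w - J k w0 - (w - w0) * (RtoC (INR (S k)) * J (S k) w0))%C
          <= eps * Cmod (w - w0)%C).
  destruct (H w) as [Hcut Hrem]; [apply Rlt_le_trans with (1 := Hw), Rmin_l|].
  pose proof (Ccont_ker k w Hcut) as C1.
  pose proof (Ccont_ker k w0 Hw0) as C2.
  pose proof (Ccont_ker (S k) w0 Hw0) as C3.
  assert (C4 : Ccont (fun s => (w - w0) * RtoC (INR (S k)) * ker (S k) w0 s)%C)
    by (apply (Ccont_mult (fun _ => (w - w0) * RtoC (INR (S k)))%C); [apply Ccont_const | exact C3]).
  rewrite Cmult_assoc; unfold J.
  rewrite <- (Cint_scal _ _ C3), <- (Cint_minus _ _ C1 C2),
    <- (Cint_minus _ _ (Ccont_minus _ _ C1 C2) C4).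
  apply Rle_trans with (K * Cmod (w - w0)%C ^ 2).
  - apply Cmod_Cint; [apply (Ccont_minus _ _ (Ccont_minus _ _ C1 C2) C4) | exact Hrem].
  - assert (Hw2 : Cmod (w - w0)%C < eps / (K + 1)) by (apply Rlt_le_trans with (1 := Hw), Rmin_r).
    assert (Hw3 : Cmod (w - w0)%C * (K + 1) < eps).
    { apply Rmult_lt_compat_r with (r := K + 1) in Hw2; [|lra].
      replace (eps / (K + 1) * (K + 1)) with eps in Hw2 by (field; lra); exact Hw2. }
    pose proof (Cmod_ge_0 (w - w0)%C); nra.
Qed.

(* The binomial coefficient [(n + k)! / (n! k!)]. *)
Definition bcoef (k n : nat) : R := poch (INR k + 1) n / INR (fact n).

Lemma poch_pos (a : R) (n : nat) : 0 < a -> 0 < poch a n.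
Proof.
  intros Ha; induction n as [|n IH]; simpl; [lra|].
  apply Rmult_lt_0_compat; [exact IH | pose proof (pos_INR n); lra].
Qed.

Lemma poch_S (a : R) (n : nat) : poch a (S n) = poch a n * (a + INR n).
Proof. reflexivity. Qed.

Lemma poch_shift (a : R) (n : nat) : poch a (S n) = a * poch (a + 1) n.
Proof.
  induction n as [|n IH]; [simpl; ring|].
  rewrite poch_S, IH, S_INR, poch_S; ring.
Qed.

Lemma bcoef_pos (k n : nat) : 0 < bcoef k n.
Proof.
  apply Rdiv_lt_0_compat; [|apply INR_fact_lt_0].
  apply poch_pos; pose proof (pos_INR k); lra.
Qed.

Lemma bcoef_0_r (k : nat) : bcoef k 0 = 1.
Proof. unfold bcoef; simpl; field. Qed.

Lemma bcoef_0_l (n : nat) : bcoef 0 n = 1.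
Proof.
  unfold bcoef; apply Rmult_eq_reg_r with (INR (fact n)); [|apply INR_fact_neq_0].
  unfold Rdiv; rewrite Rmult_assoc, Rinv_l, Rmult_1_r, Rmult_1_l by apply INR_fact_neq_0.
  induction n as [|n IH]; [reflexivity|].
  rewrite poch_S, IH, fact_simpl, mult_INR, S_INR; change (INR 0) with 0; ring.
Qed.

(** Pascal's rule; it makes multiplication by [1 - x] telescope in [binsum_S]. *)
Lemma bcoef_S_S (k n : nat) : bcoef (S k) (S n) = bcoef (S k) n + bcoef k (S n).
Proof.
  unfold bcoef; rewrite (poch_shift (INR k + 1)), poch_S, fact_simpl, mult_INR, !S_INR.
  pose proof (INR_fact_neq_0 n); pose proof (pos_INR n). field; lra.
Qed.

(** Ratio test: consecutive terms have quotient [r (1 + k / (n+1))], which tends to [r], so these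
    are the terms of a convergent series. *)
Lemma bcoef_pow_lim (k : nat) (r : R) :
  0 < r < 1 -> is_lim_seq (fun n => bcoef k n * r ^ n) 0.
Proof.
  intros Hr; apply ex_series_lim_0.
  assert (Hpos : forall n, 0 < bcoef k n * r ^ n).
  { intros n; apply Rmult_lt_0_compat; [apply bcoef_pos | apply pow_lt; lra]. }
  apply (ex_series_ext (fun n => Rabs (bcoef k n * r ^ n))).
  { intros n; apply Rabs_pos_eq, Rlt_le, Hpos. }
  apply ex_series_DAlembert with r; [lra | intros n; apply Rgt_not_eq, Hpos |].
  apply is_lim_seq_ext with (fun n => r + r * INR k * / INR (S n)).
  { intros n; rewrite Rabs_pos_eq by (apply Rlt_le, Rdiv_lt_0_compat; apply Hpos).
    unfold bcoef; rewrite fact_simpl, mult_INR, poch_S, S_INR; simpl pow.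
    pose proof (INR_fact_neq_0 n); pose proof (pos_INR n).
    assert (poch (INR k + 1) n <> 0)
      by (apply Rgt_not_eq, poch_pos; pose proof (pos_INR k); lra).
    assert (r ^ n <> 0) by (apply pow_nonzero; lra).
    field; repeat split; lra. }
  replace (Finite r) with (Rbar_plus r (Rbar_mult (r * INR k) 0))
    by (simpl; f_equal; ring).
  apply is_lim_seq_plus'; [apply is_lim_seq_const|].
  apply is_lim_seq_mult'; [apply is_lim_seq_const|].
  apply (is_lim_seq_incr_1 (fun n => / INR n)).
  apply (is_lim_seq_inv INR p_infty); [apply is_lim_seq_INR | discriminate].
Qed.

(** Truncated binomial series of [(1 - x)^(-(k+1))]. *)
Definition binsum (k n : nat) (x : C) : C :=
  Csum (fun i => RtoC (bcoef k i) * Cpow x i)%C n.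

Lemma binsum_0 (n : nat) (x : C) : ((1 - x) * binsum 0 n x = 1 - Cpow x (S n))%C.
Proof.
  unfold binsum; induction n as [|n IH].
  - rewrite Csum_0, bcoef_0_l, Cpow_0_r, Cpow_1_r; ring.
  - rewrite Csum_S, Cmult_plus_distr_l, IH, bcoef_0_l, !Cpow_S; ring.
Qed.

Lemma binsum_S (k n : nat) (x : C) :
  ((1 - x) * binsum (S k) n x = binsum k n x - RtoC (bcoef (S k) n) * Cpow x (S n))%C.
Proof.
  unfold binsum; induction n as [|n IH].
  - rewrite !Csum_0, !bcoef_0_r, Cpow_0_r, Cpow_1_r; ring.
  - rewrite !Csum_S, Cmult_plus_distr_l, IH, bcoef_S_S, RtoC_plus, !Cpow_S; ring.
Qed.

(** Induction on [k] through [binsum_S]: each division by [1 - x] costs a factor [1 / (1 - r)] and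
    adds a boundary term that tends to 0. The error depends on [r] only, as termwise integration
    requires. *)
Lemma binsum_error (k : nat) (r : R) :
  0 < r < 1 ->
  exists e, is_lim_seq e 0 /\ forall (x : C) (n : nat), Cmod x <= r ->
    Cmod (binsum k n x - Cpow (/ (1 - x)) (S k))%C <= e n.
Proof.
  intros Hr.
  assert (Hx : forall x, Cmod x <= r -> 1 - r <= Cmod (1 - x)%C).
  { intros x H; pose proof (Cmod_reverse_triangle 1 x) as H1; rewrite Cmod_1 in H1; lra. }
  assert (Hpow : forall x n, Cmod x <= r -> Cmod (Cpow x (S n)) <= r ^ n).
  { intros x n H; rewrite Cmod_pow; pose proof (Cmod_ge_0 x).
    apply Rle_trans with (r ^ S n); [apply pow_incr; lra|].
    simpl; pose proof (pow_le r n); nra. }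
  induction k as [|k [e [He IH]]].
  - exists (fun n => / (1 - r) * r ^ n); split.
    + replace (Finite 0) with (Rbar_mult (/ (1 - r)) 0) by (simpl; f_equal; ring).
      apply is_lim_seq_mult'; [apply is_lim_seq_const | apply is_lim_seq_geom].
      rewrite Rabs_pos_eq; lra.
    + intros x n H; specialize (Hx x H).
      assert (H0 : (1 - x)%C <> 0%C) by (apply Cmod_gt_0; lra).
      replace (binsum 0 n x - Cpow (/ (1 - x)) 1)%C with (/ (1 - x) * - Cpow x (S n))%C.
      * rewrite Cmod_mult, Cmod_opp.
        apply Rmult_le_compat; auto using Cmod_ge_0.
        apply Cmod_inv_le; lra.
      * rewrite Cpow_1_r.
        replace (binsum 0 n x) with (/ (1 - x) * ((1 - x) * binsum 0 n x))%C by (field; exact H0).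
        rewrite binsum_0; ring.
  - exists (fun n => / (1 - r) * (e n + bcoef (S k) n * r ^ n)); split.
    + replace (Finite 0) with (Rbar_mult (/ (1 - r)) (Rbar_plus 0 0)) by (simpl; f_equal; ring).
      apply is_lim_seq_mult'; [apply is_lim_seq_const|].
      apply is_lim_seq_plus'; [exact He | apply bcoef_pow_lim, Hr].
    + intros x n H; specialize (Hx x H).
      assert (H0 : (1 - x)%C <> 0%C) by (apply Cmod_gt_0; lra).
      replace (binsum (S k) n x - Cpow (/ (1 - x)) (S (S k)))%C with
        (/ (1 - x) * ((binsum k n x - Cpow (/ (1 - x)) (S k))
                      - RtoC (bcoef (S k) n) * Cpow x (S n)))%C.
      * rewrite Cmod_mult; apply Rmult_le_compat; auto using Cmod_ge_0.
        { apply Cmod_inv_le; lra. }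
        unfold Cminus at 1; apply Rle_trans with (1 := Cmod_triangle _ _).
        rewrite Cmod_opp, Cmod_mult, Cmod_R, (Rabs_pos_eq (bcoef _ _)) by apply Rlt_le, bcoef_pos.
        apply Rplus_le_compat; [apply IH, H|].
        apply Rmult_le_compat_l; [apply Rlt_le, bcoef_pos | apply Hpow, H].
      * replace (binsum (S k) n x) with (/ (1 - x) * ((1 - x) * binsum (S k) n x))%C
          by (field; exact H0).
        rewrite binsum_S, (Cpow_S _ (S k)); ring.
Qed.

Lemma Cint_monomial (n : nat) : Cint (fun s => RtoC (s ^ n)) = RtoC (/ (INR n + 1)).
Proof.
  apply Cint_unique.
  apply (is_RInt_fct_extend_pair (U := R_NormedModule) (V := R_NormedModule)); simpl.
  - replace (/ (INR n + 1)) with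
      (minus (G := R_AbelianGroup) (1 ^ S n / (INR n + 1)) (0 ^ S n / (INR n + 1))).
    2: { unfold minus, plus, opp; simpl; rewrite pow1.
         pose proof (pos_INR n); field; lra. }
    apply (is_RInt_derive (V := R_CompleteNormedModule) (fun s => s ^ S n / (INR n + 1))).
    + intros s _; auto_derive; [trivial|].
      change (match n with 0%nat => 1 | S _ => INR n + 1 end) with (INR (S n)).
      rewrite S_INR; pose proof (pos_INR n); field; lra.
    + intros s _; apply continuous_pow.
  - pose proof (is_RInt_const (V := R_NormedModule) 0 1 0) as H.
    replace (scal (1 - 0) (0 : R_NormedModule)) with 0 in H; [exact H|].
    unfold scal; simpl; unfold mult; simpl; ring.
Qed.

(** The quotient of the Pochhammer symbols at [k + 1/2] and [k + 3/2] telescopes to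
    [(2k+1) / (2k+2n+1)], and [1 / (2k+2n+1)] is the integral of [s^(2k+2n)]. *)
Lemma hyp_coef (k n : nat) :
  poch (INR k + / 2) n * poch (INR k + 1) n / poch (INR k + 3 / 2) n / INR (fact n)
  = (2 * INR k + 1) * bcoef k n * / (INR (2 * k + 2 * n) + 1).
Proof.
  assert (H : poch (INR k + / 2) n * (INR k + / 2 + INR n)
              = (INR k + / 2) * poch (INR k + 3 / 2) n).
  { replace (INR k + 3 / 2) with (INR k + / 2 + 1) by field.
    rewrite <- poch_shift; reflexivity. }
  unfold bcoef; rewrite plus_INR, !mult_INR; change (INR 2) with 2.
  pose proof (pos_INR k); pose proof (pos_INR n); pose proof (INR_fact_neq_0 n).
  assert (poch (INR k + 3 / 2) n <> 0) by (apply Rgt_not_eq, poch_pos; lra).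
  replace (poch (INR k + / 2) n) with
    ((INR k + / 2) * poch (INR k + 3 / 2) n / (INR k + / 2 + INR n))
    by (rewrite <- H; field; lra).
  field; repeat split; lra.
Qed.

Lemma Cmod_lt_1_cut_plane (w : C) : Cmod w < 1 -> cut_plane w.
Proof.
  intros Hw [_ H]; pose proof (re_le_Cmod w) as H1.
  rewrite Rabs_pos_eq in H1; lra.
Qed.

Lemma is_series_hyp (k : nat) (w : C) :
  Cmod w < 1 ->
  is_series (V := C_NormedModule)
    (hyp_term (INR k + / 2) (INR k + 1) (INR k + 3 / 2) w)
    (RtoC (2 * INR k + 1) * J k w)%C.
Proof.
  intros Hw; pose proof (Cmod_ge_0 w) as Hw0.
  (* The midpoint of [|w|] and 1 stays strictly positive even for [w = 0]. *)
  destruct (binsum_error k ((Cmod w + 1) / 2)) as [e [He Hbin]]; [lra|].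
  assert (Hc : forall n, Ccont (fun s => RtoC (s ^ (2 * k + 2 * n)))).
  { intros n; apply Ccont_RtoC; intros s; apply continuous_pow. }
  apply is_series_C_ext with (fun n => RtoC (2 * INR k + 1) *
    Cint (fun s => RtoC (bcoef k n) * Cpow w n * RtoC (s ^ (2 * k + 2 * n))))%C.
  { intros n; rewrite (Cint_scal _ _ (Hc n)), Cint_monomial.
    unfold hyp_term; rewrite hyp_coef, !RtoC_mult; ring. }
  apply is_series_C_scal, is_series_Cint with (e := e); [ | | | exact He].
  - intros n; apply (Ccont_mult (fun _ => RtoC (bcoef k n) * Cpow w n)%C);
      [apply Ccont_const | apply Hc].
  - apply Ccont_ker, Cmod_lt_1_cut_plane, Hw.
  - intros n s Hs; destruct (unit_pow s 2 Hs).
    assert (Hx : Cmod (w * RtoC (s ^ 2))%C <= (Cmod w + 1) / 2).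
    { rewrite Cmod_mult, Cmod_R, Rabs_pos_eq by assumption; nra. }
    specialize (Hbin _ n Hx).
    replace (Csum _ n) with (RtoC (s ^ (2 * k)) * binsum k n (w * RtoC (s ^ 2)))%C.
    2: { unfold binsum; rewrite <- Csum_scal; apply Csum_ext; intros i _.
         rewrite Cpow_mult_l, <- RtoC_pow, <- pow_mult, pow_add, RtoC_mult; ring. }
    unfold ker; replace (_ - _)%C with (RtoC (s ^ (2 * k)) * (binsum k n (w * RtoC (s ^ 2))
      - Cpow (/ (1 - w * RtoC (s ^ 2))) (S k)))%C by ring.
    rewrite Cmod_mult, Cmod_R; destruct (unit_pow s (2 * k) Hs).
    rewrite Rabs_pos_eq by assumption.
    pose proof (Cmod_ge_0 (binsum k n (w * RtoC (s ^ 2)) - Cpow (/ (1 - w * RtoC (s ^ 2))) (S k))%C).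
    nra.
Qed.

Lemma is_series_C_unique (a : nat -> C) (l1 l2 : C) :
  is_series (V := C_NormedModule) a l1 -> is_series (V := C_NormedModule) a l2 -> l1 = l2.
Proof.
  intros H1 H2; exact (filterlim_locally_unique (V := C_NormedModule) _ _ _ H1 H2).
Qed.

Lemma ex_derive_C_cont (f : C -> C) (x : C) (eps : R) :
  ex_derive (K := C_AbsRing) (V := C_NormedModule) f x -> 0 < eps ->
  exists d, 0 < d /\ forall y, Cmod (y - x)%C < d -> Cmod (f y - f x)%C < eps.
Proof.
  intros H Heps.
  pose proof (ex_derive_continuous f x H) as Hc; unfold continuous in Hc.
  rewrite (filterlim_locally_ball_norm (U := C_NormedModule)) in Hc.
  destruct (Hc (mkposreal eps Heps)) as [[d Hd] Hball].
  exists d; split; [exact Hd | intros y Hy; exact (Hball y Hy)].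
Qed.

(* [-1] lies on the circle of convergence but off the cut, so continuity alone determines
   the value of the continuation there. *)
Lemma hyp2F1_value_unique (a b c : R) (v1 v2 : C) :
  is_hyp2F1_value a b c (RtoC (-1)) v1 -> is_hyp2F1_value a b c (RtoC (-1)) v2 -> v1 = v2.
Proof.
  intros [f [Df [Sf <-]]] [g [Dg [Sg <-]]].
  assert (Hcut : cut_plane (RtoC (-1))) by (intros [_ H]; simpl in H; lra).
  destruct (Req_dec (Cmod (f (RtoC (-1)) - g (RtoC (-1)))%C) 0) as [H0|H0].
  { apply Cmod_eq_0 in H0.
    replace (f (RtoC (-1))) with (f (RtoC (-1)) - g (RtoC (-1)) + g (RtoC (-1)))%C by ring.
    rewrite H0; ring. }
  exfalso.
  assert (Heps : 0 < Cmod (f (RtoC (-1)) - g (RtoC (-1)))%C / 2).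
  { pose proof (Cmod_ge_0 (f (RtoC (-1)) - g (RtoC (-1)))%C); lra. }
  destruct (ex_derive_C_cont f _ _ (Df _ Hcut) Heps) as [d1 [Hd1 H1]].
  destruct (ex_derive_C_cont g _ _ (Dg _ Hcut) Heps) as [d2 [Hd2 H2]].
  (* The point [-1 + t] is inside the unit disc, where both continuations equal the series, and
     close enough to -1 for both continuity bounds. *)
  set (t := Rmin (Rmin d1 d2) 1 / 2).
  assert (Ht : 0 < t < d1 /\ t < d2 /\ t < 1).
  { unfold t; pose proof (Rmin_l (Rmin d1 d2) 1); pose proof (Rmin_r (Rmin d1 d2) 1).
    pose proof (Rmin_l d1 d2); pose proof (Rmin_r d1 d2).
    assert (0 < Rmin (Rmin d1 d2) 1) by (repeat apply Rmin_glb_lt; lra); lra. }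
  assert (Hy : Cmod (RtoC (-1 + t) - RtoC (-1))%C = t).
  { rewrite <- RtoC_minus, Cmod_R, Rabs_pos_eq; lra. }
  specialize (H1 (RtoC (-1 + t))); specialize (H2 (RtoC (-1 + t))).
  rewrite Hy in H1, H2; specialize (H1 ltac:(lra)); specialize (H2 ltac:(lra)).
  assert (Hin : Cmod (RtoC (-1 + t)) < 1) by (rewrite Cmod_R; apply Rabs_def1; lra).
  rewrite (is_series_C_unique _ _ _ (Sf _ Hin) (Sg _ Hin)) in H1.
  set (y := g (RtoC (-1 + t))) in *.
  pose proof (Cmod_triangle (f (RtoC (-1)) - y) (y - g (RtoC (-1)))) as H.
  replace (f (RtoC (-1)) - y + (y - g (RtoC (-1))))%C
    with (f (RtoC (-1)) - g (RtoC (-1)))%C in H by ring.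
  rewrite <- (Cmod_opp (f (RtoC (-1)) - y)) in H.
  replace (- (f (RtoC (-1)) - y))%C with (y - f (RtoC (-1)))%C in H by ring.
  lra.
Qed.

Lemma ker_real (k : nat) (s : R) :
  ker k (RtoC (-1)) s = RtoC (s ^ (2 * k) * (/ (1 + s ^ 2)) ^ S k).
Proof.
  pose proof (pow2_ge_0 s).
  unfold ker; rewrite <- RtoC_mult, <- RtoC_minus, <- RtoC_inv, <- RtoC_pow, <- RtoC_mult by lra.
  now replace (1 - -1 * s ^ 2) with (1 + s ^ 2) by ring.
Qed.

(** At -1 the integrand is real, so the imaginary component integrates the zero function. This
    supplies the real witness that [hyp2F1_J] needs. *)
Lemma J_real (k : nat) : exists r : R, J k (RtoC (-1)) = RtoC r.
Proof.
  exists (Re (J k (RtoC (-1)))); apply injective_projections; [reflexivity|].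
  assert (Hm : cut_plane (RtoC (-1))) by (intros [_ H]; simpl in H; lra).
  pose proof (is_RInt_Cint _ (Ccont_ker k _ Hm)) as H.
  apply (is_RInt_fct_extend_snd (U := R_NormedModule) (V := R_NormedModule)) in H.
  pose proof (is_RInt_const (V := R_NormedModule) 0 1 0) as H0.
  apply (is_RInt_ext (V := R_NormedModule) _ (fun s => snd (ker k (RtoC (-1)) s))) in H0.
  2: { intros s _; rewrite ker_real; reflexivity. }
  change (snd (Cint (ker k (RtoC (-1)))) = 0).
  transitivity (RInt (V := R_CompleteNormedModule) (fun s => snd (ker k (RtoC (-1)) s)) 0 1).
  - symmetry; apply (is_RInt_unique (V := R_CompleteNormedModule)), H.
  - rewrite (is_RInt_unique (V := R_CompleteNormedModule) _ _ _ _ H0).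
    unfold scal; simpl; unfold mult; simpl; ring.
Qed.

Lemma hyp2F1_J (k : nat) :
  hyp2F1 (INR k + / 2) (INR k + 1) (INR k + 3 / 2) (RtoC (-1))
  = (RtoC (2 * INR k + 1) * J k (RtoC (-1)))%C.
Proof.
  assert (H : is_hyp2F1_value (INR k + / 2) (INR k + 1) (INR k + 3 / 2) (RtoC (-1))
                (RtoC (2 * INR k + 1) * J k (RtoC (-1)))%C).
  { exists (fun w => RtoC (2 * INR k + 1) * J k w)%C; split; [|split; [|reflexivity]].
    - intros w Hw.
      exists (RtoC (2 * INR k + 1) * (RtoC (INR (S k)) * J (S k) w))%C.
      eapply filterdiff_ext_lin.
      + apply (filterdiff_scal_r_fct (U := AbsRing_NormedModule C_AbsRing) (V := C_NormedModule)
          (RtoC (2 * INR k + 1))); [exact Cmult_comm | apply (is_derive_J k w Hw)].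
      + intros y; change (RtoC (2 * INR k + 1) * (y * (RtoC (INR (S k)) * J (S k) w))
          = y * (RtoC (2 * INR k + 1) * (RtoC (INR (S k)) * J (S k) w)))%C; ring.
    - intros w Hw; apply is_series_hyp, Hw. }
  refine (hyp2F1_value_unique _ _ _ _ _ _ H).
  destruct (J_real k) as [r Hr]; rewrite Hr, <- RtoC_mult in H.
  (* The [epsilon] inside [hyp2F1] ranges over [R] and is coerced to [C], so the witness must be
     real. *)
  exact (epsilon_spec (inhabits 0) (fun v : R => is_hyp2F1_value (INR k + / 2) (INR k + 1)
    (INR k + 3 / 2) (RtoC (-1)) (RtoC v)) (ex_intro _ ((2 * INR k + 1) * r) H)).
Qed.

(** * Expansion of [J 0] around -1 *)

Lemma inv_one_plus_sqr (s : R) : 0 < / (1 + s ^ 2) <= 1.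
Proof.
  pose proof (pow2_ge_0 s); split; [apply Rinv_0_lt_compat; lra|].
  apply Rmult_le_reg_r with (1 + s ^ 2); [lra|]; rewrite Rinv_l; lra.
Qed.

(** Equality holds at [s = 1]. This constant yields both the radius 2 in [J_expansion] and the decay
    rate in [Cmod_J]. *)
Lemma sqr_over_one_plus_sqr (s : R) : 0 <= s <= 1 -> s ^ 2 * / (1 + s ^ 2) <= / 2.
Proof.
  intros Hs; pose proof (unit_pow s 2 Hs).
  apply Rmult_le_reg_r with (1 + s ^ 2); [lra|].
  rewrite Rmult_assoc, Rinv_l; lra.
Qed.

(** With [p0 = 1 / (1 + s^2)] one has [1 - w s^2 = (1 - (w+1) s^2 p0) / p0], and the ratio
    [(w+1) s^2 p0] has modulus at most [|w+1| / 2 < 1]. The geometric series, [binsum] at [k = 0],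
    is thus uniform in [s]. *)
Lemma J_expansion (w : C) :
  Cmod (w + 1)%C < 2 ->
  is_series (V := C_NormedModule) (fun k => Cpow (w + 1) k * J k (RtoC (-1)))%C (J 0 w).
Proof.
  intros Hw; pose proof (Cmod_ge_0 (w + 1)%C) as Hw0.
  destruct (binsum_error 0 ((Cmod (w + 1)%C / 2 + 1) / 2)) as [e [He Hbin]]; [lra|].
  assert (Hm : cut_plane (RtoC (-1))) by (intros [_ H]; simpl in H; lra).
  assert (Hcut : cut_plane w).
  { intros [_ H]; pose proof (re_le_Cmod (w + 1)%C) as H1; destruct w as [a b]; simpl in H, H1.
    rewrite Rabs_pos_eq in H1; lra. }
  apply is_series_C_ext with (fun k => Cint (fun s => Cpow (w + 1) k * ker k (RtoC (-1)) s)%C).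
  { intros k; apply Cint_scal, Ccont_ker, Hm. }
  apply is_series_Cint with (e := e); [ | apply Ccont_ker, Hcut | | exact He].
  { intros k; apply (Ccont_mult (fun _ => Cpow (w + 1) k)); [apply Ccont_const | apply Ccont_ker, Hm]. }
  intros n s Hs; pose proof (unit_pow s 2 Hs) as Hs2.
  pose proof (cut_plane_neq _ s Hcut Hs) as Hq.
  set (p0 := (/ RtoC (1 + s ^ 2))%C).
  assert (Hp : RtoC (1 + s ^ 2) <> 0%C) by (intros E; injection E; lra).
  assert (Hp0 : Cmod p0 = / (1 + s ^ 2)).
  { unfold p0; rewrite Cmod_inv, Cmod_R, Rabs_pos_eq by (try exact Hp; lra); reflexivity. }
  assert (Hx : Cmod ((w + 1) * RtoC (s ^ 2) * p0)%C <= (Cmod (w + 1)%C / 2 + 1) / 2).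
  { rewrite !Cmod_mult, Hp0, Cmod_R, Rabs_pos_eq by lra.
    pose proof (sqr_over_one_plus_sqr s Hs).
    rewrite Rmult_assoc; nra. }
  specialize (Hbin _ n Hx).
  replace (Csum _ n) with (p0 * binsum 0 n ((w + 1) * RtoC (s ^ 2) * p0))%C.
  2: { unfold binsum; rewrite <- Csum_scal; apply Csum_ext; intros i _.
       unfold ker; rewrite bcoef_0_l, !Cpow_mult_l, <- RtoC_pow, <- pow_mult, Cpow_S.
       replace (/ (1 - RtoC (-1) * RtoC (s ^ 2)))%C with p0
         by (unfold p0; f_equal; rewrite RtoC_plus; ring).
       ring. }
  replace (ker 0 w s) with (p0 * Cpow (/ (1 - (w + 1) * RtoC (s ^ 2) * p0)) 1)%C.
  2: { unfold ker, p0; rewrite !Cpow_1_r, RtoC_plus; change (s ^ (2 * 0)) with 1.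
       rewrite RtoC_plus in Hp; field; split; [exact Hq | exact Hp]. }
  match goal with |- Cmod ?x <= _ =>
    replace x with (p0 * (binsum 0 n ((w + 1) * RtoC (s ^ 2) * p0)
       - Cpow (/ (1 - (w + 1) * RtoC (s ^ 2) * p0)) 1))%C by ring end.
  rewrite Cmod_mult, Hp0.
  pose proof (inv_one_plus_sqr s).
  match goal with |- _ * ?x <= _ => assert (0 <= x) by apply Cmod_ge_0 end.
  nra.
Qed.

Lemma Cmod_J (k : nat) : Cmod (J k (RtoC (-1))) <= (/ 2) ^ k.
Proof.
  assert (Hm : cut_plane (RtoC (-1))) by (intros [_ H]; simpl in H; lra).
  apply Cmod_Cint; [apply Ccont_ker, Hm|].
  intros s Hs; pose proof (unit_pow s 2 Hs) as Hs2.
  rewrite ker_real, Cmod_R.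
  pose proof (inv_one_plus_sqr s) as Hi; pose proof (sqr_over_one_plus_sqr s Hs).
  replace (s ^ (2 * k) * (/ (1 + s ^ 2)) ^ S k)
    with ((s ^ 2 * / (1 + s ^ 2)) ^ k * / (1 + s ^ 2))
    by (rewrite Rpow_mult_distr, <- pow_mult; simpl pow; ring).
  assert (Hb : 0 <= (s ^ 2 * / (1 + s ^ 2)) ^ k <= (/ 2) ^ k).
  { assert (0 <= s ^ 2 * / (1 + s ^ 2)) by (apply Rmult_le_pos; lra).
    split; [apply pow_le | apply pow_incr]; lra. }
  rewrite Rabs_pos_eq by (apply Rmult_le_pos; lra); nra.
Qed.

(** * The exponential series and Stirling numbers *)

Lemma Cexp_plus (x y : C) : Cexp (x + y) = (Cexp x * Cexp y)%C.
Proof.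
  destruct x as [a b], y as [c d]; unfold Cexp; simpl.
  rewrite exp_plus, cos_plus, sin_plus.
  apply injective_projections; simpl; ring.
Qed.

Lemma Cexp_0 : Cexp (RtoC 0) = RtoC 1.
Proof.
  unfold Cexp; simpl; rewrite exp_0, cos_0, sin_0.
  apply injective_projections; simpl; ring.
Qed.

Lemma Cmod_Cexp (z : C) : Cmod (Cexp z) = exp (Re z).
Proof.
  unfold Cmod, Cexp; simpl fst; simpl snd.
  replace (_ + _) with (exp (Re z) ^ 2); [apply sqrt_pow2, Rlt_le, exp_pos|].
  pose proof (sin2_cos2 (Im z)) as H; unfold Rsqr in H.
  transitivity (exp (Re z) ^ 2 * (sin (Im z) * sin (Im z) + cos (Im z) * cos (Im z)));
    [rewrite H; ring | ring].
Qed.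

(** The [n]-th derivative in [t] of the real function [Re (c exp (t z))]. Real Taylor-Lagrange then
    applies to the complex exponential; [c] selects the component, 1 for the real and [-i] for the
    imaginary part. *)
Definition exp_ray (c z : C) (n : nat) (t : R) : R :=
  Re (c * Cpow z n * Cexp (RtoC t * z))%C.

Lemma is_derive_exp_ray (c z : C) (n : nat) (t : R) :
  is_derive (exp_ray c z n) t (exp_ray c z (S n) t).
Proof.
  unfold exp_ray; rewrite Cpow_S.
  replace (c * (z * Cpow z n))%C with (c * Cpow z n * z)%C by ring.
  destruct (c * Cpow z n)%C as [c1 c2]; destruct z as [a b]; unfold Cexp; simpl.
  auto_derive; [trivial | unfold Rminus; ring].
Qed.

Lemma Derive_n_exp_ray (c z : C) (n : nat) (t : R) :
  Derive_n (exp_ray c z 0) n t = exp_ray c z n t.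
Proof.
  revert t; induction n as [|n IH]; intros t; [reflexivity|].
  simpl; rewrite (Derive_ext _ (exp_ray c z n)) by exact IH.
  apply is_derive_unique, is_derive_exp_ray.
Qed.

Lemma Re_scal_Csum (c : C) (a : nat -> C) (n : nat) :
  Re (c * Csum a n)%C = sum_f_R0 (fun m => Re (c * a m)%C) n.
Proof.
  induction n as [|n IH]; [now rewrite Csum_0|].
  rewrite Csum_S, tech5, <- IH; simpl; ring.
Qed.

Definition exp_term (z : C) (n : nat) : C := (RtoC (/ INR (fact n)) * Cpow z n)%C.

Lemma Cmod_le_Re_Im (z : C) : Cmod z <= Rabs (Re z) + Rabs (Im z).
Proof.
  replace z with (RtoC (Re z) + Ci * RtoC (Im z))%C at 1
    by (destruct z; apply injective_projections; simpl; ring).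
  apply Rle_trans with (1 := Cmod_triangle _ _).
  rewrite Cmod_mult, Cmod_Ci, !Cmod_R; lra.
Qed.

(** Lagrange's remainder on [0,1], where the intermediate point [x] satisfies [x Re z <= |z|]. *)
Lemma Cexp_remainder_Re (c z : C) (n : nat) :
  Rabs (Re (c * (Csum (exp_term z) n - Cexp z))%C)
    <= Cmod c * (exp (Cmod z) * (/ INR (fact (S n)) * Cmod z ^ S n)).
Proof.
  destruct (Taylor_Lagrange (exp_ray c z 0) n 0 1) as [x [Hx Hf]]; [lra | |].
  { intros t _ [|k] _; [exact I|].
    exists (exp_ray c z (S k) t).
    apply is_derive_ext with (exp_ray c z k); [intros u; symmetry; apply Derive_n_exp_ray|].
    apply is_derive_exp_ray. }
  rewrite Derive_n_exp_ray in Hf.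
  rewrite (sum_eq _ (fun m => Re (c * exp_term z m)%C)) in Hf.
  2: { intros m _; rewrite Derive_n_exp_ray, Rminus_0_r, pow1; unfold exp_ray, exp_term.
       rewrite Cmult_0_l, Cexp_0.
       destruct (Cpow z m) as [z1 z2], c as [c1 c2]; simpl; field; apply INR_fact_neq_0. }
  rewrite <- Re_scal_Csum, Rminus_0_r, pow1 in Hf.
  assert (H1 : exp_ray c z 0 1 = Re (c * Cexp z)%C).
  { unfold exp_ray; rewrite Cmult_1_l, Cpow_0_r, Cmult_1_r; reflexivity. }
  rewrite H1 in Hf.
  replace (Re (c * (Csum (exp_term z) n - Cexp z))%C)
    with (- (1 / INR (fact (S n)) * exp_ray c z (S n) x)).
  2: { replace (Re (c * (Csum (exp_term z) n - Cexp z))%C)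
         with (Re (c * Csum (exp_term z) n)%C - Re (c * Cexp z)%C) by (simpl; ring).
       rewrite Hf; ring. }
  rewrite Rabs_Ropp, Rabs_mult.
  pose proof (INR_fact_lt_0 (S n)) as Hfact; pose proof (Rinv_0_lt_compat _ Hfact).
  rewrite Rabs_pos_eq by (unfold Rdiv; lra).
  assert (Hray : Rabs (exp_ray c z (S n) x) <= Cmod c * Cmod z ^ S n * exp (Cmod z)).
  { apply Rle_trans with (1 := re_le_Cmod _).
    rewrite !Cmod_mult, Cmod_pow; apply Rmult_le_compat_l.
    - apply Rmult_le_pos; [|apply pow_le]; apply Cmod_ge_0.
    - rewrite Cmod_Cexp; replace (Re (RtoC x * z)%C) with (x * Re z) by (unfold Re; simpl; ring).
      destruct (Req_dec (x * Re z) (Cmod z)) as [->|Hne]; [lra|].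
      apply Rlt_le, exp_increasing.
      pose proof (re_le_Cmod z); pose proof (Rle_abs (Re z)); pose proof (Cmod_ge_0 z).
      assert (x * Re z <= Cmod z) by nra; lra. }
  unfold Rdiv; rewrite Rmult_1_l.
  apply Rle_trans with (/ INR (fact (S n)) * (Cmod c * Cmod z ^ S n * exp (Cmod z))).
  - apply Rmult_le_compat_l; [lra | exact Hray].
  - right; ring.
Qed.

Lemma is_series_Cexp (z : C) :
  is_series (V := C_NormedModule) (exp_term z) (Cexp z).
Proof.
  apply is_series_C_le with
    (* The factor 2 adds the bounds for the real and the imaginary part. *)
    (fun n => 2 * exp (Cmod z) * (/ INR (fact (S n)) * Cmod z ^ S n)).
  - intros n; apply Rle_trans with (1 := Cmod_le_Re_Im _).
    pose proof (Cexp_remainder_Re 1 z n) as H1.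
    pose proof (Cexp_remainder_Re (- Ci) z n) as H2.
    rewrite Cmult_1_l, Cmod_1 in H1; rewrite Cmod_opp, Cmod_Ci in H2.
    replace (Re (- Ci * (Csum (exp_term z) n - Cexp z))%C)
      with (Im (Csum (exp_term z) n - Cexp z)%C) in H2 by (simpl; ring).
    lra.
  - replace (Finite 0) with (Rbar_mult (2 * exp (Cmod z)) 0) by (simpl; f_equal; ring).
    apply is_lim_seq_mult'; [apply is_lim_seq_const|].
    apply (is_lim_seq_incr_1 (fun n => / INR (fact n) * Cmod z ^ n)).
    apply ex_series_lim_0; exists (exp (Cmod z)).
    apply is_series_ext with (2 := is_exp_Reals (Cmod z)).
    intros n; unfold scal; simpl; unfold mult; simpl; rewrite pow_n_pow; ring.
Qed.

(** The [k]-th forward difference of [g] at [m]. It enters because [(e^v - 1)^k] is the [k]-th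
    difference of [m -> e^(m v)] at 0. *)
Fixpoint fdiff (k : nat) (g : nat -> R) (m : nat) : R :=
  match k with
  | O => g m
  | S k' => fdiff k' g (S m) - fdiff k' g m
  end.

Lemma fdiff_const (k : nat) (c : R) (m : nat) : fdiff (S k) (fun _ => c) m = 0.
Proof.
  revert m; induction k as [|k IH]; intros m; [simpl; ring|].
  change (fdiff (S k) (fun _ => c) (S m) - fdiff (S k) (fun _ => c) m = 0).
  rewrite !IH; ring.
Qed.

(** Leibniz rule for differences: the factor [j] has constant first difference 1, so only two terms
    survive. *)
Lemma fdiff_mult_id (k : nat) (g : nat -> R) (m : nat) :
  fdiff (S k) (fun j => INR j * g j) m
  = INR m * fdiff (S k) g m + INR (S k) * fdiff k g (S m).
Proof.
  revert m; induction k as [|k IH]; intros m.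
  - change (INR (S m) * g (S m) - INR m * g m = INR m * (g (S m) - g m) + INR 1 * g (S m)).
    rewrite S_INR; change (INR 1) with 1; ring.
  - change (fdiff (S (S k)) (fun j => INR j * g j) m)
      with (fdiff (S k) (fun j => INR j * g j) (S m) - fdiff (S k) (fun j => INR j * g j) m).
    rewrite !IH.
    change (fdiff (S (S k)) g m) with (fdiff (S k) g (S m) - fdiff (S k) g m).
    rewrite !S_INR; simpl fdiff; ring.
Qed.

Lemma fdiff_pow_stirling (n k : nat) :
  fdiff k (fun j => INR j ^ n) 0 = INR (fact k) * INR (stirling2 n k).
Proof.
  revert k; induction n as [|n IH]; intros [|k].
  - simpl; ring.
  - change (fun j : nat => INR j ^ 0) with (fun _ : nat => 1).
    rewrite fdiff_const; simpl; ring.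
  - simpl; ring.
  - change (fun j : nat => INR j ^ S n) with (fun j : nat => INR j * INR j ^ n).
    rewrite fdiff_mult_id.
    (* At [m = 0] the Leibniz rule leaves only a difference based at 1; moving the base to 0 splits
       it into the two terms of the Stirling recurrence. *)
    replace (fdiff k (fun j => INR j ^ n) 1)
      with (fdiff (S k) (fun j => INR j ^ n) 0 + fdiff k (fun j => INR j ^ n) 0) by (simpl; ring).
    rewrite !IH; change (stirling2 (S n) (S k))
      with (S k * stirling2 n (S k) + stirling2 n k)%nat.
    rewrite fact_simpl, plus_INR, !mult_INR; change (INR 0) with 0; ring.
Qed.

(** The base point [m] is kept general because the induction subtracts the series at [m] from the
    one at [m + 1], using [e^((m+1)v) - e^(mv) = (e^v - 1) e^(mv)]. *)
Lemma is_series_fdiff (k m : nat) (v : C) :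
  is_series (V := C_NormedModule)
    (fun n => RtoC (fdiff k (fun j => INR j ^ n)%R m / INR (fact n)) * Cpow v n)%C
    (Cpow (Cexp v - 1) k * Cexp (RtoC (INR m) * v))%C.
Proof.
  revert m; induction k as [|k IH]; intros m.
  - rewrite Cpow_0_r, Cmult_1_l.
    apply is_series_C_ext with (2 := is_series_Cexp _).
    intros n; unfold exp_term; rewrite Cpow_mult_l, <- RtoC_pow; simpl fdiff.
    unfold Rdiv; rewrite RtoC_mult; ring.
  - pose proof (is_series_minus (V := C_NormedModule) _ _ _ _ (IH (S m)) (IH m)) as H.
    replace (Cpow (Cexp v - 1) (S k) * Cexp (RtoC (INR m) * v))%C with
      (Cpow (Cexp v - 1) k * Cexp (RtoC (INR (S m)) * v)
       - Cpow (Cexp v - 1) k * Cexp (RtoC (INR m) * v))%C.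
    + apply is_series_C_ext with (2 := H); intros n.
      change (RtoC (fdiff k (fun j => INR j ^ n)%R (S m) / INR (fact n)) * Cpow v n -
        RtoC (fdiff k (fun j => INR j ^ n)%R m / INR (fact n)) * Cpow v n =
        RtoC ((fdiff k (fun j => INR j ^ n)%R (S m) - fdiff k (fun j => INR j ^ n)%R m)
              / INR (fact n)) * Cpow v n)%C.
      unfold Rdiv; rewrite Rmult_minus_distr_r, RtoC_minus; ring.
    + rewrite S_INR, RtoC_plus, Cmult_plus_distr_r, Cmult_1_l, Cexp_plus, Cpow_S; ring.
Qed.

Definition stirling_term (k : nat) (v : C) (n : nat) : C :=
  (RtoC (INR (fact k) * INR (stirling2 n k) / INR (fact n)) * Cpow v n)%C.

Lemma is_series_stirling (k : nat) (v : C) :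
  is_series (V := C_NormedModule) (stirling_term k v) (Cpow (Cexp v - 1) k).
Proof.
  pose proof (is_series_fdiff k 0 v) as H.
  replace (Cpow (Cexp v - 1) k * Cexp (RtoC (INR 0) * v))%C with (Cpow (Cexp v - 1) k) in H.
  - apply is_series_C_ext with (2 := H); intros n; now rewrite fdiff_pow_stirling.
  - change (INR 0) with 0; rewrite Cmult_0_l, Cexp_0; ring.
Qed.

Lemma Cexp_RtoC (r : R) : Cexp (RtoC r) = RtoC (exp r).
Proof. unfold Cexp; simpl; rewrite cos_0, sin_0, Rmult_1_r, Rmult_0_r; reflexivity. Qed.

Lemma Csum_RtoC (a : nat -> R) (n : nat) : Csum (fun k => RtoC (a k)) n = RtoC (sum_n a n).
Proof.
  induction n as [|n IH]; [now rewrite Csum_0, sum_O|].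
  rewrite Csum_S, IH, sum_Sn, <- RtoC_plus; reflexivity.
Qed.

(** The coefficients are nonnegative, so the partial sums at [|v|] dominate those at [v] and
    increase to their limit [(e^|v| - 1)^k]. The bound is uniform in [n]. *)
Lemma Csum_stirling_le (k : nat) (v : C) (n : nat) :
  Cmod (Csum (stirling_term k v) n) <= (exp (Cmod v) - 1) ^ k.
Proof.
  set (a := fun n => INR (fact k) * INR (stirling2 n k) / INR (fact n) * Cmod v ^ n).
  assert (Ha : forall n, 0 <= a n).
  { intros m; apply Rmult_le_pos; [|apply pow_le, Cmod_ge_0].
    apply Rmult_le_pos; [apply Rmult_le_pos; apply pos_INR|].
    apply Rlt_le, Rinv_0_lt_compat, INR_fact_lt_0. }
  apply Rle_trans with (sum_n a n).
  { apply Cmod_Csum; intros m _; unfold stirling_term, a.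
    rewrite Cmod_mult, Cmod_pow, Cmod_R; right; f_equal; apply Rabs_pos_eq.
    apply Rmult_le_pos; [apply Rmult_le_pos; apply pos_INR|].
    apply Rlt_le, Rinv_0_lt_compat, INR_fact_lt_0. }
  apply (is_lim_seq_incr_compare (sum_n a)).
  2: { intros m; rewrite sum_Sn; specialize (Ha (S m)); unfold plus; simpl; lra. }
  pose proof (is_series_stirling k (RtoC (Cmod v))) as H.
  apply is_series_C_iff in H.
  apply is_lim_seq_ext with (fun m => (sum_n a m - (exp (Cmod v) - 1) ^ k) + (exp (Cmod v) - 1) ^ k);
    [intros m; ring|].
  replace (Finite ((exp (Cmod v) - 1) ^ k)) with (Rbar_plus 0 ((exp (Cmod v) - 1) ^ k))
    by (simpl; f_equal; ring).
  apply is_lim_seq_plus'; [|apply is_lim_seq_const].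
  apply is_lim_seq_abs_0; apply is_lim_seq_ext with (2 := H); intros m.
  rewrite (Csum_ext _ (fun i => RtoC (a i))).
  - rewrite Csum_RtoC, Cexp_RtoC, <- RtoC_minus, <- RtoC_pow, <- RtoC_minus, Cmod_R; reflexivity.
  - intros i _; unfold stirling_term, a; rewrite <- RtoC_pow, <- RtoC_mult; reflexivity.
Qed.

Lemma is_series_C_bound (a : nat -> C) (l : C) (M : R) :
  is_series (V := C_NormedModule) a l -> (forall n, Cmod (Csum a n) <= M) -> Cmod l <= M.
Proof.
  intros H HM; apply is_series_C_iff in H.
  apply (is_lim_seq_le (fun _ => Cmod l) (fun n => M + Cmod (Csum a n - l)%C)
    (Cmod l) M).
  - intros n; pose proof (Cmod_reverse_triangle l (Csum a n)) as H1.
    replace (l - Csum a n)%C with (- (Csum a n - l))%C in H1 by ring.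
    rewrite Cmod_opp in H1; specialize (HM n); lra.
  - apply is_lim_seq_const.
  - replace (Finite M) with (Rbar_plus M 0) by (simpl; f_equal; ring).
    apply is_lim_seq_plus'; [apply is_lim_seq_const | exact H].
Qed.

Lemma Cmod_Cexp_minus_1 (v : C) : Cmod (Cexp v - 1)%C <= exp (Cmod v) - 1.
Proof.
  pose proof (is_series_C_bound _ _ _ (is_series_stirling 1 v) (Csum_stirling_le 1 v)) as H.
  rewrite Cpow_1_r, pow_1 in H; exact H.
Qed.

(** * Interchange of summations *)

Lemma is_lim_seq_Cmod_plus (u v : nat -> C) :
  is_lim_seq (fun n => Cmod (u n)) 0 -> is_lim_seq (fun n => Cmod (v n)) 0 ->
  is_lim_seq (fun n => Cmod (u n + v n)%C) 0.
Proof.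
  intros Hu Hv; apply is_lim_seq_le_0 with (fun n => Cmod (u n) + Cmod (v n)).
  - intros n; split; [apply Cmod_ge_0 | apply Cmod_triangle].
  - replace (Finite 0) with (Rbar_plus 0 0) by (simpl; f_equal; ring).
    apply is_lim_seq_plus'; assumption.
Qed.

Lemma Cmod_Csum_tail (a : nat -> C) (b : nat -> R) (m n : nat) :
  (forall k, Cmod (a k) <= b k) -> (m <= n)%nat ->
  Cmod (Csum a n) <= Cmod (Csum a m) + (sum_n b n - sum_n b m).
Proof.
  intros H Hmn; induction Hmn as [|n Hmn IH]; [lra|].
  rewrite Csum_S, sum_Sn; unfold plus; simpl.
  pose proof (Cmod_triangle (Csum a n) (a (S n))); specialize (H (S n)); lra.
Qed.

(** Dominated convergence for sums whose length grows with [n]: past a fixed [m] the tail of [b] is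
    below [eps / 2], and the first [m + 1] terms tend to 0 together. *)
Lemma Tannery (g : nat -> nat -> C) (b : nat -> R) :
  ex_series b -> (forall n k, Cmod (g n k) <= b k) ->
  (forall k, is_lim_seq (fun n => Cmod (g n k)) 0) ->
  is_lim_seq (fun n => Cmod (Csum (g n) n)) 0.
Proof.
  intros [B HB] Hg Hlim.
  assert (Hfin : forall m, is_lim_seq (fun n => Cmod (Csum (g n) m)) 0).
  { induction m as [|m IH].
    - apply is_lim_seq_ext with (fun n => Cmod (g n 0%nat)); [intros n; now rewrite Csum_0 | apply Hlim].
    - apply is_lim_seq_ext with (fun n => Cmod (Csum (g n) m + g n (S m))%C);
        [intros n; now rewrite Csum_S | apply is_lim_seq_Cmod_plus; auto]. }
  assert (HBlim : is_lim_seq (sum_n b) B) by exact HB.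
  assert (Hincr : forall n, sum_n b n <= B).
  { intros n; apply (is_lim_seq_incr_compare (sum_n b)); [exact HBlim|].
    intros m; rewrite sum_Sn; unfold plus; simpl.
    pose proof (Cmod_ge_0 (g 0%nat (S m))); specialize (Hg 0%nat (S m)); lra. }
  apply is_lim_seq_spec; intros eps.
  apply is_lim_seq_spec in HBlim.
  destruct (HBlim (pos_div_2 eps)) as [m Hm]; specialize (Hm m (Nat.le_refl m)).
  pose proof (Hfin m) as Hm2; apply is_lim_seq_spec in Hm2.
  destruct (Hm2 (pos_div_2 eps)) as [n0 Hn0].
  exists (Nat.max m n0); intros n Hn.
  specialize (Hn0 n ltac:(lia)); rewrite Rminus_0_r, Rabs_pos_eq in * by apply Cmod_ge_0.
  pose proof (Cmod_Csum_tail (g n) b m n (Hg n) ltac:(lia)) as H.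
  specialize (Hincr n); apply Rabs_def2 in Hm; simpl in Hm, Hn0; lra.
Qed.

(** Zeros above the diagonal turn the sum of the first rows into a square, which can be summed by
    columns. The column errors are dominated by [2 b k], once for the partial sum and once for its
    limit, so [Tannery] applies. *)
Lemma is_series_triangular (t : nat -> nat -> C) (T : nat -> C) (b : nat -> R) (L : C) :
  (forall n k, (n < k)%nat -> t n k = 0%C) ->
  (forall k, is_series (V := C_NormedModule) (fun n => t n k) (T k)) ->
  (forall k n, Cmod (Csum (fun i => t i k) n) <= b k) ->
  ex_series b ->
  is_series (V := C_NormedModule) T L ->
  is_series (V := C_NormedModule) (fun n => Csum (t n) n) L.
Proof.
  intros Htri HT Hb Hex HL.
  assert (Hpad : forall n m, (n <= m)%nat -> Csum (t n) m = Csum (t n) n).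
  { intros n m Hnm; induction Hnm as [|m Hnm IH]; [reflexivity|].
    rewrite Csum_S, IH, Htri by lia; ring. }
  apply is_series_C_iff.
  apply is_lim_seq_ext with (fun n => Cmod
    (Csum (fun k => Csum (fun i => t i k) n - T k) n + (Csum T n - L))%C).
  { intros n; f_equal; rewrite Csum_minus, <- Csum_switch.
    rewrite (Csum_ext (fun i => Csum (t i) n) (fun i => Csum (t i) i)) by auto; ring. }
  apply is_lim_seq_Cmod_plus; [|apply is_series_C_iff, HL].
  apply (Tannery (fun n k => Csum (fun i => t i k) n - T k)%C (fun k => 2 * b k)).
  - apply (ex_series_scal_l 2 b Hex).
  - intros n k; unfold Cminus; apply Rle_trans with (1 := Cmod_triangle _ _).
    rewrite Cmod_opp; pose proof (is_series_C_bound _ _ _ (HT k) (Hb k)).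
    specialize (Hb k n); lra.
  - intros k; apply is_series_C_iff, HT.
Qed.

(** * The logarithm as an integral *)

(** The plane without the nonpositive real axis, written as the union of the regions on which [Carg]
    is given by a single arctangent formula. *)
Definition slit (w : C) : Prop := 0 < Re w \/ Im w <> 0.

Lemma slit_neq_0 (w : C) : slit w -> w <> 0%C.
Proof. intros [H|H] ->; simpl in H; lra. Qed.

Lemma Carg_re_pos (w : C) : 0 < Re w -> Carg w = atan (Im w / Re w).
Proof. intros H; unfold Carg; destruct (Rlt_dec 0 (Re w)); [reflexivity | contradiction]. Qed.

Lemma atan_div_swap (x y : R) : 0 < x -> 0 < y -> atan (y / x) = PI / 2 - atan (x / y).
Proof.
  intros Hx Hy; rewrite <- atan_inv by (apply Rdiv_lt_0_compat; assumption).
  f_equal; field; lra.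
Qed.

(** With the quotient inverted, one formula covers the whole upper half plane, across the imaginary
    axis where the definition changes case. *)
Lemma Carg_im_pos (w : C) : 0 < Im w -> Carg w = PI / 2 - atan (Re w / Im w).
Proof.
  intros Hy; unfold Carg.
  destruct (Rlt_dec 0 (Re w)) as [Hx|Hx]; [apply atan_div_swap; assumption|].
  destruct (Rlt_dec (Re w) 0) as [Hx'|Hx'].
  - destruct (Rle_dec 0 (Im w)) as [_|Hn]; [|lra].
    pose proof (atan_div_swap (- Re w) (Im w) ltac:(lra) Hy) as H.
    replace (Im w / - Re w) with (- (Im w / Re w)) in H by (field; lra).
    replace (- Re w / Im w) with (- (Re w / Im w)) in H by (field; lra).
    rewrite !atan_opp in H; lra.
  - destruct (Rlt_dec 0 (Im w)) as [_|Hn]; [|lra].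
    replace (Re w / Im w) with 0 by (replace (Re w) with 0 by lra; field; lra); rewrite atan_0; ring.
Qed.

Lemma Carg_im_neg (w : C) : Im w < 0 -> Carg w = - (PI / 2) - atan (Re w / Im w).
Proof.
  intros Hy; unfold Carg.
  destruct (Rlt_dec 0 (Re w)) as [Hx|Hx].
  - pose proof (atan_div_swap (Re w) (- Im w) Hx ltac:(lra)) as H.
    replace (- Im w / Re w) with (- (Im w / Re w)) in H by (field; lra).
    replace (Re w / - Im w) with (- (Re w / Im w)) in H by (field; lra).
    rewrite !atan_opp in H; lra.
  - destruct (Rlt_dec (Re w) 0) as [Hx'|Hx'].
    + destruct (Rle_dec 0 (Im w)) as [Hn|_]; [lra|].
      pose proof (atan_div_swap (- Re w) (- Im w) ltac:(lra) ltac:(lra)) as H.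
      replace (- Im w / - Re w) with (Im w / Re w) in H by (field; lra).
      replace (- Re w / - Im w) with (Re w / Im w) in H by (field; lra).
      lra.
    + destruct (Rlt_dec 0 (Im w)) as [Hn|_]; [lra|].
      destruct (Rlt_dec (Im w) 0) as [_|Hn]; [|lra].
      replace (Re w / Im w) with 0 by (replace (Re w) with 0 by lra; field; lra); rewrite atan_0; ring.
Qed.

Lemma Carg_bounds (w : C) : slit w -> - PI < Carg w < PI.
Proof.
  pose proof PI_RGT_0.
  intros [Hx|Hy].
  - rewrite Carg_re_pos by exact Hx; pose proof (atan_bound (Im w / Re w)); lra.
  - pose proof (atan_bound (Re w / Im w)).
    destruct (Rlt_or_le 0 (Im w)).
    + rewrite Carg_im_pos by assumption; lra.
    + rewrite Carg_im_neg by lra; lra.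
Qed.

Lemma Cmod_factor (x y : R) : 0 < x -> sqrt (x ^ 2 + y ^ 2) = x * sqrt (1 + (y / x)²).
Proof.
  intros Hx; rewrite <- (sqrt_pow2 x) at 2 by lra.
  rewrite <- sqrt_mult_alt by apply pow2_ge_0.
  f_equal; unfold Rsqr; field; lra.
Qed.

Lemma sqrt_one_plus_sqr_pos (t : R) : 0 < sqrt (1 + t²).
Proof. apply sqrt_lt_R0; pose proof (Rle_0_sqr t); lra. Qed.

Lemma Carg_polar (w : C) : slit w ->
  Cmod w * cos (Carg w) = Re w /\ Cmod w * sin (Carg w) = Im w.
Proof.
  destruct w as [x y]; unfold slit, Cmod; simpl fst; simpl snd; intros [Hx|Hy]; simpl in *.
  - rewrite (Carg_re_pos (x, y) Hx); simpl.
    replace (x * (x * 1) + y * (y * 1)) with (x ^ 2 + y ^ 2) by (simpl; ring).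
    rewrite (Cmod_factor x y Hx), cos_atan, sin_atan.
    pose proof (sqrt_one_plus_sqr_pos (y / x)); split; field; lra.
  - replace (x * (x * 1) + y * (y * 1)) with (y ^ 2 + x ^ 2) by (simpl; ring).
    pose proof (sqrt_one_plus_sqr_pos (x / y)).
    destruct (Rlt_or_le 0 y) as [Hp|Hn].
    + rewrite (Carg_im_pos (x, y) Hp), cos_shift, sin_shift; unfold Re, Im, fst, snd.
      rewrite (Cmod_factor y x Hp), cos_atan, sin_atan; split; field; lra.
    + assert (Hn' : y < 0) by lra.
      rewrite (Carg_im_neg (x, y) Hn'); unfold Re, Im, fst, snd.
      replace (- (PI / 2) - atan (x / y)) with (- (PI / 2 - atan (- (x / y))))
        by (rewrite atan_opp; ring).
      rewrite cos_neg, sin_neg, cos_shift, sin_shift, atan_opp, cos_neg, sin_neg.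
      replace (y ^ 2 + x ^ 2) with ((- y) ^ 2 + x ^ 2) by ring.
      rewrite (Cmod_factor (- y) x), cos_atan, sin_atan by lra.
      replace ((x / - y)²) with ((x / y)²) by (unfold Rsqr; field; lra).
      split; field; lra.
Qed.

Lemma Cexp_Cln (w : C) : slit w -> Cexp (Cln w) = w.
Proof.
  intros Hw; destruct (Carg_polar w Hw) as [H1 H2].
  unfold Cexp, Cln; simpl; rewrite exp_ln by (apply Cmod_gt_0, slit_neq_0, Hw).
  rewrite H1, H2; destruct w; reflexivity.
Qed.

Lemma Csqrt_mult (w : C) : slit w -> (Csqrt w * Csqrt w)%C = w.
Proof.
  intros Hw; unfold Csqrt; destruct (Ceq_dec w 0) as [H|_]; [now apply slit_neq_0 in Hw|].
  rewrite <- Cexp_plus; replace (Cln w * / 2 + Cln w * / 2)%C with (Cln w).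
  - apply Cexp_Cln, Hw.
  - apply injective_projections; simpl; field.
Qed.

(** Halving an argument in [(-PI, PI)] lands where the cosine is positive. *)
Lemma Csqrt_re_pos (w : C) : slit w -> 0 < Re (Csqrt w).
Proof.
  intros Hw; unfold Csqrt; destruct (Ceq_dec w 0) as [H|_]; [now apply slit_neq_0 in Hw|].
  destruct (Carg_bounds w Hw) as [H1 H2].
  unfold Cexp; simpl Re; apply Rmult_lt_0_compat; [apply exp_pos|].
  apply cos_gt_0; simpl; unfold Cln; simpl; lra.
Qed.

Lemma locally_affine_pos (a b s : R) : 0 < a + s * b -> locally s (fun t => 0 < a + t * b).
Proof.
  intros H.
  assert (Hc : continuous (fun t : R => a + t * b) s).
  { apply (ex_derive_continuous (V := R_NormedModule)); auto_derive; trivial. }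
  apply (Hc (fun y => 0 < y)), (open_gt 0 _ H).
Qed.

(** With [v = a + i b] the derivative is the imaginary part of [v / (1 + s v)];
    [is_derive_ln_Cmod_line] gives the real part. *)
Lemma is_derive_Carg_line (a b s : R) :
  slit (1 + s * a, s * b) ->
  is_derive (fun t => Carg (1 + t * a, t * b)) s
    ((b * (1 + s * a) - a * (s * b)) / ((1 + s * a) ^ 2 + (s * b) ^ 2)).
Proof.
  intros [Hx|Hy]; simpl in *.
  - apply is_derive_ext_loc with (fun t => atan (t * b / (1 + t * a))).
    { apply filter_imp with (2 := locally_affine_pos 1 a s Hx); intros t Ht.
      symmetry; apply (Carg_re_pos (1 + t * a, t * b) Ht). }
    auto_derive; [lra|].
    unfold Rsqr; simpl; field; nra.
  - pose proof (Rsqr_pos_lt _ Hy) as Hsq; pose proof (Rle_0_sqr (1 + s * a)) as Hsq'.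
    unfold Rsqr in Hsq, Hsq'.
    destruct (Rlt_or_le 0 (s * b)) as [Hp|Hn].
    + apply is_derive_ext_loc with (fun t => PI / 2 - atan ((1 + t * a) / (t * b))).
      { rewrite <- (Rplus_0_l (s * b)) in Hp.
        apply filter_imp with (2 := locally_affine_pos 0 b s Hp); intros t Ht.
        rewrite Rplus_0_l in Ht; symmetry; apply (Carg_im_pos (1 + t * a, t * b) Ht). }
      auto_derive; [lra|].
      assert (b <> 0) by (intros E; apply Hy; rewrite E; ring).
      assert (s <> 0) by (intros E; apply Hy; rewrite E; ring).
      unfold Rsqr; simpl; field; split; [lra | split; assumption].
    + apply is_derive_ext_loc with (fun t => - (PI / 2) - atan ((1 + t * a) / (t * b))).
      { assert (Hp : 0 < 0 + s * - b) by lra.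
        apply filter_imp with (2 := locally_affine_pos 0 (- b) s Hp); intros t Ht.
        symmetry; apply (Carg_im_neg (1 + t * a, t * b)); simpl; lra. }
      auto_derive; [lra|].
      assert (b <> 0) by (intros E; apply Hy; rewrite E; ring).
      assert (s <> 0) by (intros E; apply Hy; rewrite E; ring).
      unfold Rsqr; simpl; field; split; [lra | split; assumption].
Qed.

Lemma is_derive_ln_Cmod_line (a b s : R) :
  slit (1 + s * a, s * b) ->
  is_derive (fun t => ln (Cmod (1 + t * a, t * b))) s
    ((a * (1 + s * a) + b * (s * b)) / ((1 + s * a) ^ 2 + (s * b) ^ 2)).
Proof.
  intros H; apply slit_neq_0, C_sqr_pos in H; simpl fst in H; simpl snd in H.
  unfold Cmod; simpl fst; simpl snd.
  pose proof (sqrt_lt_R0 _ H) as Hs.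
  auto_derive; [split; [exact H | split; [exact Hs | trivial]]|].
  replace ((1 + s * a) * ((1 + s * a) * 1) + s * b * (s * b * 1))
    with ((1 + s * a) ^ 2 + (s * b) ^ 2) by ring.
  transitivity ((a * (1 + s * a) + b * (s * b)) /
    (sqrt ((1 + s * a) ^ 2 + (s * b) ^ 2) * sqrt ((1 + s * a) ^ 2 + (s * b) ^ 2))).
  - field; lra.
  - rewrite sqrt_sqrt by lra; reflexivity.
Qed.

Definition line_quot (v : C) (s : R) : C := (v / (1 + RtoC s * v))%C.

Lemma Ccont_line_quot (v : C) :
  (forall s, 0 <= s <= 1 -> slit (1 + RtoC s * v)%C) -> Ccont (line_quot v).
Proof.
  intros H; apply (Ccont_mult (fun _ => v)); [apply Ccont_const|].
  apply Ccont_inv; [intros s Hs; apply slit_neq_0, H, Hs|].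
  apply Ccont_plus; [apply Ccont_const|].
  apply (Ccont_mult RtoC (fun _ => v)); [|apply Ccont_const].
  apply (Ccont_RtoC (fun s => s)); intros s; apply continuous_id.
Qed.

(** Fundamental theorem of calculus along the segment from 1 to [1 + v]; the lower end contributes
    the logarithm of 1, which is 0. *)
Lemma Cint_line_quot (v : C) :
  (forall s, 0 <= s <= 1 -> slit (1 + RtoC s * v)%C) -> Cint (line_quot v) = Cln (1 + v)%C.
Proof.
  intros H; pose proof (Ccont_line_quot v H) as Hc; apply Cint_unique.
  destruct v as [a b].
  assert (Hline : forall s, (1 + RtoC s * (a, b))%C = (1 + s * a, s * b))
    by (intros s; apply injective_projections; simpl; ring).
  assert (Hslit : forall s, 0 <= s <= 1 -> slit (1 + s * a, s * b))
    by (intros s Hs; rewrite <- Hline; apply H, Hs).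
  assert (H1 : (1 + (a, b))%C = (1 + 1 * a, 1 * b))
    by (apply injective_projections; simpl; ring).
  rewrite H1; unfold Cln.
  assert (H0 : (1 + 0 * a, 0 * b) = RtoC 1) by (apply injective_projections; simpl; ring).
  apply (is_RInt_fct_extend_pair (U := R_NormedModule) (V := R_NormedModule)).
  - replace (ln (Cmod (1 + 1 * a, 1 * b))) with
      (minus (G := R_AbelianGroup) (ln (Cmod (1 + 1 * a, 1 * b))) (ln (Cmod (1 + 0 * a, 0 * b))))
      by (rewrite H0, Cmod_1, ln_1; unfold minus, plus, opp; simpl; ring).
    apply (is_RInt_derive (V := R_CompleteNormedModule) (fun s => ln (Cmod (1 + s * a, s * b))));
      intros s; rewrite Rmin_left, Rmax_right by lra; intros Hs; [|apply (Hc s Hs)].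
    assert (E : (a * (1 + s * a) + b * (s * b)) / ((1 + s * a) ^ 2 + (s * b) ^ 2) = fst (line_quot (a, b) s)).
    { unfold line_quot; rewrite Hline.
      pose proof (C_sqr_pos _ (slit_neq_0 _ (Hslit s Hs))) as Hq.
      simpl in Hq |- *; field; lra. }
    pose proof (is_derive_ln_Cmod_line a b s (Hslit s Hs)) as D; rewrite E in D; exact D.
  - replace (Carg (1 + 1 * a, 1 * b)) with
      (minus (G := R_AbelianGroup) (Carg (1 + 1 * a, 1 * b)) (Carg (1 + 0 * a, 0 * b))).
    2: { rewrite H0, (Carg_re_pos (RtoC 1)) by (simpl; lra); simpl.
         replace (0 / 1) with 0 by field; rewrite atan_0; unfold minus, plus, opp; simpl; ring. }
    apply (is_RInt_derive (V := R_CompleteNormedModule) (fun s => Carg (1 + s * a, s * b)));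
      intros s; rewrite Rmin_left, Rmax_right by lra; intros Hs; [|apply (Hc s Hs)].
    assert (E : (b * (1 + s * a) - a * (s * b)) / ((1 + s * a) ^ 2 + (s * b) ^ 2) = snd (line_quot (a, b) s)).
    { unfold line_quot; rewrite Hline.
      pose proof (C_sqr_pos _ (slit_neq_0 _ (Hslit s Hs))) as Hq.
      simpl in Hq |- *; field; lra. }
    pose proof (is_derive_Carg_line a b s (Hslit s Hs)) as D; rewrite E in D; exact D.
Qed.

(** * The arctangent and [W] as Euler integrals *)

Lemma Carctan_J (u : C) : 0 < Re u -> Carctan u = (u * J 0 (- (u * u)))%C.
Proof.
  intros Hu.
  (* The imaginary parts are [s Re u] and [- s Re u], nonzero for [s > 0]; at [s = 0] both points
     are 1. *)
  assert (Hslit : forall s, 0 <= s <= 1 ->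
    slit (1 + RtoC s * (Ci * u))%C /\ slit (1 + RtoC s * - (Ci * u))%C).
  { intros s Hs; destruct u as [a b]; unfold slit; simpl in *.
    destruct (Req_dec s 0) as [->|Hs0]; [split; left; lra|].
    assert (s * a <> 0) by (apply Rmult_integral_contrapositive; lra).
    split; right; lra. }
  assert (H1 : forall s, 0 <= s <= 1 -> slit (1 + RtoC s * (Ci * u))%C) by (intros; apply Hslit; assumption).
  assert (H2 : forall s, 0 <= s <= 1 -> slit (1 + RtoC s * - (Ci * u))%C) by (intros; apply Hslit; assumption).
  pose proof (Ccont_line_quot _ H1) as C1; pose proof (Ccont_line_quot _ H2) as C2.
  unfold Carctan; unfold Cminus at 2.
  rewrite <- (Cint_line_quot _ H1), <- (Cint_line_quot _ H2).
  rewrite <- (Cint_minus _ _ C2 C1), <- (Cint_scal _ _ (Ccont_minus _ _ C2 C1)).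
  (* Partial fractions: with [A = 1 + i s u] and [B = 1 - i s u], [1/A + 1/B = 2 / (A B)] and
     [A B = 1 + s^2 u^2]. *)
  assert (Hpt : forall s, 0 <= s <= 1 ->
    (Ci * / 2 * (line_quot (- (Ci * u)) s - line_quot (Ci * u) s) = u * ker 0 (- (u * u)) s)%C).
  { intros s Hs; specialize (H1 s Hs); specialize (H2 s Hs).
    apply slit_neq_0 in H1; apply slit_neq_0 in H2.
    unfold line_quot, ker; rewrite Cpow_1_r; change (s ^ (2 * 0)) with 1.
    set (A := (1 + RtoC s * (Ci * u))%C) in *; set (B := (1 + RtoC s * - (Ci * u))%C) in *.
    assert (HAB : (1 - - (u * u) * RtoC (s ^ 2) = A * B)%C).
    { unfold A, B; apply injective_projections; destruct u; simpl; ring. }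
    assert (Hsum : (A + B = 2)%C) by (unfold A, B; apply injective_projections; destruct u; simpl; ring).
    assert (Hi : (Ci * Ci = - (1))%C) by (apply injective_projections; simpl; ring).
    rewrite HAB.
    transitivity (- (Ci * Ci) * u * ((A + B) / 2) / (A * B))%C.
    - field; split; assumption.
    - rewrite Hi, Hsum; field; split; assumption. }
  rewrite (Cint_ext _ _ Hpt); apply Cint_scal, Ccont_mult.
  - apply Ccont_RtoC; intros s; apply continuous_pow.
  - apply Ccont_pow, Ccont_inv; [|apply Ccont_ker_base].
    intros s Hs E; destruct (Hslit s Hs) as [S1 S2].
    apply (Cmult_neq_0 _ _ (slit_neq_0 _ S1) (slit_neq_0 _ S2)).
    rewrite <- E; apply injective_projections; destruct u; simpl; ring.
Qed.

Lemma Im_le_Cmod (z : C) : Rabs (Im z) <= Cmod z.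
Proof. apply Rle_trans with (2 := Rmax_Cmod z), Rmax_r. Qed.

(** For real [z], [exp (-z) > 1/2] makes the radicand positive. Otherwise [0 < |Im z| < ln 2 < PI],
    so the sine and hence the imaginary part do not vanish. *)
Lemma slit_radicand (z : C) : Cmod z < ln 2 -> slit (2 * Cexp (- z) - 1)%C.
Proof.
  intros Hz; pose proof (re_le_Cmod z) as Hre; pose proof (Im_le_Cmod z) as Him.
  assert (Hln : ln 2 < PI).
  { apply Rlt_trans with 1; [|pose proof PI2_1; lra].
    rewrite <- (ln_exp 1); apply ln_increasing; [lra|].
    pose proof (exp_ineq1 1); lra. }
  destruct z as [x y]; unfold slit; simpl in *.
  assert (Hx : x < ln 2) by (pose proof (Rle_abs x); lra).
  assert (Hy : - PI < y < PI) by (destruct (Rabs_def2 y PI); lra).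
  destruct (Req_dec y 0) as [->|Hy0].
  - left; rewrite Ropp_0, cos_0, sin_0.
    assert (/ 2 < exp (- x)).
    { rewrite <- (exp_ln (/ 2)), ln_Rinv by lra; apply exp_increasing; lra. }
    lra.
  - right; rewrite sin_neg.
    assert (Hsin : sin y <> 0).
    { destruct (Rlt_or_le 0 y).
      - apply Rgt_not_eq, sin_gt_0; lra.
      - pose proof (sin_gt_0 (- y)) as H1; rewrite sin_neg in H1; lra. }
    pose proof (exp_pos (- x)).
    assert (exp (- x) * sin y <> 0) by (apply Rmult_integral_contrapositive; lra).
    lra.
Qed.

(** The factor [u] of [Carctan_J] cancels, leaving a function of [u^2 = 2 exp (-z) - 1] alone. *)
Lemma W_J (z : C) : Cmod z < ln 2 -> W z = J 0 (1 - 2 * Cexp (- z))%C.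
Proof.
  intros Hz; pose proof (slit_radicand z Hz) as Hs.
  unfold W; cbv zeta; set (u := Csqrt (2 * Cexp (- z) - 1)).
  pose proof (Csqrt_re_pos _ Hs : 0 < Re u) as Hu.
  assert (Hu0 : u <> 0%C) by (intros E; rewrite E in Hu; simpl in Hu; lra).
  rewrite (Carctan_J u Hu).
  replace (- (u * u))%C with (1 - 2 * Cexp (- z))%C
    by (unfold u; rewrite (Csqrt_mult _ Hs); ring).
  field; exact Hu0.
Qed.

(** * Coefficients and the final exchange of sums *)

(** The denominator [2k + 1] cancels against the factor in [hyp2F1_J], and the [2^k] of the double
    factorial joins the sign. *)
Lemma coef_J (n : nat) :
  coef n = Csum (fun k => RtoC ((-2) ^ k * INR (fact k) * INR (stirling2 n k))
                          * J k (RtoC (-1)))%C n.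
Proof.
  apply Csum_ext; intros k _; rewrite hyp2F1_J, Cmult_assoc, <- RtoC_mult; f_equal; f_equal.
  unfold dfact_even; rewrite mult_INR, pow_INR; change (INR 2) with 2.
  replace (-2) with (-1 * 2) by ring; rewrite Rpow_mult_distr.
  pose proof (pos_INR k); field; lra.
Qed.

Lemma stirling2_gt (n k : nat) : (n < k)%nat -> stirling2 n k = 0%nat.
Proof.
  revert k; induction n as [|n IH]; intros [|k] H; try lia; [reflexivity|].
  simpl; rewrite !IH by lia; lia.
Qed.

Theorem theorem4p1 :
  forall z : C, Cmod z < ln 2 ->
    is_series (V := C_NormedModule)
      (fun n => Cmult (RtoC ((-1) ^ n / INR (fact n))) (Cmult (coef n) (Cpow z n)))
      (W z).
Proof.
  intros z Hz; rewrite (W_J z Hz).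
  (* Working with [-z] absorbs the sign [(-1)^n]. *)
  set (v := (- z)%C).
  assert (Hv : exp (Cmod v) - 1 < 1).
  { unfold v; rewrite Cmod_opp.
    assert (exp (Cmod z) < exp (ln 2)) by (apply exp_increasing, Hz).
    rewrite exp_ln in * by lra; lra. }
  assert (Hv0 : 0 <= exp (Cmod v) - 1).
  { pose proof (Cmod_Cexp_minus_1 v); pose proof (Cmod_ge_0 (Cexp v - 1)%C); lra. }
  (* Grouping [(-2)^k] with the integral gives coefficients bounded by 1, so the geometric bound on
     the Stirling sums alone controls the double series. *)
  set (c := fun k => (RtoC ((-2) ^ k) * J k (RtoC (-1)))%C).
  assert (Hc : forall k, Cmod (c k) <= 1).
  { intros k; unfold c; rewrite Cmod_mult, Cmod_R, <- RPow_abs.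
    replace (Rabs (-2)) with 2 by (rewrite Rabs_left; lra).
    apply Rle_trans with (2 ^ k * (/ 2) ^ k).
    - apply Rmult_le_compat_l; [apply pow_le; lra | apply Cmod_J].
    - rewrite <- Rpow_mult_distr, Rinv_r, pow1; lra. }
  apply is_series_C_ext with (fun n => Csum (fun k => c k * stirling_term k v n)%C n).
  { intros n; rewrite coef_J, (Cmult_comm (Csum _ _)), <- !Csum_scal.
    apply Csum_ext; intros k _; unfold c, stirling_term, v.
    replace (Cpow (- z) n) with (RtoC ((-1) ^ n) * Cpow z n)%C.
    - unfold Rdiv; rewrite !RtoC_mult; ring.
    - rewrite RtoC_pow, <- Cpow_mult_l; f_equal; apply injective_projections; simpl; ring. }
  apply is_series_triangular with
    (T := fun k => (c k * Cpow (Cexp v - 1) k)%C) (b := fun k => (exp (Cmod v) - 1) ^ k).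
  - intros n k Hnk; unfold stirling_term; rewrite (stirling2_gt n k Hnk); simpl INR.
    unfold Rdiv; rewrite Rmult_0_r, Rmult_0_l; ring.
  - intros k; apply is_series_C_scal, is_series_stirling.
  - intros k n; rewrite Csum_scal, Cmod_mult.
    pose proof (Csum_stirling_le k v n); pose proof (Cmod_ge_0 (Csum (stirling_term k v) n)).
    pose proof (Cmod_ge_0 (c k)); specialize (Hc k); nra.
  - apply ex_series_geom; rewrite Rabs_pos_eq; assumption.
  (* With [w = 1 - 2 e^v] one has [w + 1 = -2 (e^v - 1)], so the radius 2 of [J_expansion] becomes
     [|e^v - 1| < 1]. *)
  - assert (Hw : Cmod (1 - 2 * Cexp v + 1)%C < 2).
    { replace (1 - 2 * Cexp v + 1)%C with (- (2 * (Cexp v - 1)))%C by ring.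
      rewrite Cmod_opp, Cmod_mult, Cmod_R, Rabs_pos_eq by lra.
      pose proof (Cmod_Cexp_minus_1 v); lra. }
    apply is_series_C_ext with (2 := J_expansion _ Hw); intros k.
    replace (1 - 2 * Cexp v + 1)%C with (RtoC (-2) * (Cexp v - 1))%C.
    + unfold c; rewrite Cpow_mult_l, <- RtoC_pow; ring.
    + apply injective_projections; destruct (Cexp v); simpl; ring.
Qed.
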